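(* Let $(h,u,v)$ be a (sufficiently smooth) solution of the linearized shallow water system with smooth bottom topography $b$, so that it satisfies the exact integral equations at $P=(x,y,t_n+\tau)$, $\tau=\Delta t/2$, given in the context. Then the following is a first order approximation of the exact integral equations, i.e. as $\Delta t\to0$: $$h(P)=-b(P)+\frac1{2\pi}\int_0^{2\pi}\Big[(h(Q)+b(Q))-\frac{\tilde c}g\big(u(Q)\cos\theta+v(Q)\sin\theta\big)\Big]d\theta-\frac1{2\pi}\int_{t_n}^{t_n+\tau}\frac1{t_n+\tau-\tilde t}\int_0^{2\pi}\frac{\tilde c}g\big(u(\tilde Q)\cos\theta+v(\tilde Q)\sin\theta\big)d\theta\,d\tilde t+\frac1{2\pi}\int_{t_n}^{t_n+\tau}\int_0^{2\pi}\big(\tilde ub_x(\tilde Q)+\tilde vb_y(\tilde Q)\big)d\theta\,d\tilde t+\mathcal O(\Delta t^2),$$ $$u(P)=\frac1{2\pi}\int_0^{2\pi}\Big[-\frac1{\tilde c}K(Q)\cos\theta+u(Q)\cos^2\theta+v(Q)\sin\theta\cos\theta\Big]d\theta+\frac12u(Q_0)-\frac1{2\pi}\int_{t_n}^{t_n+\tau}\frac1{t_n+\tau-\tilde t}\int_0^{2\pi}\frac1{\tilde c}K(\tilde Q)\cos\theta\,d\theta\,d\tilde t+\frac1{2\pi}\int_{t_n}^{t_n+\tau}\frac1{t_n+\tau-\tilde t}\int_0^{2\pi}\big(u(\tilde Q)\cos2\theta+v(\tilde Q)\sin2\theta\big)d\theta\,d\tilde t+\mathcal O(\Delta t^2),$$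 $$v(P)=\frac1{2\pi}\int_0^{2\pi}\Big[-\frac1{\tilde c}L(Q)\sin\theta+u(Q)\sin\theta\cos\theta+v(Q)\sin^2\theta\Big]d\theta+\frac12v(Q_0)-\frac1{2\pi}\int_{t_n}^{t_n+\tau}\frac1{t_n+\tau-\tilde t}\int_0^{2\pi}\frac1{\tilde c}L(\tilde Q)\sin\theta\,d\theta\,d\tilde t+\frac1{2\pi}\int_{t_n}^{t_n+\tau}\frac1{t_n+\tau-\tilde t}\int_0^{2\pi}\big(u(\tilde Q)\sin2\theta-v(\tilde Q)\cos2\theta\big)d\theta\,d\tilde t+\mathcal O(\Delta t^2).$$
   Context: Linearized shallow water system in primitive variables, with constants $\tilde h>0,\tilde u,\tilde v$, gravitational constant $g>0$, Coriolis parameter $f$, bottom topography $b=b(x,y)$ (time independent): $h_t+\tilde uh_x+\tilde vh_y+\tilde h(u_x+v_y)=0$, $\;u_t+\tilde uu_x+\tilde vu_y+gh_x=-gb_x+fv$, $\;v_t+\tilde uv_x+\tilde vv_y+gh_y=-gb_y-fu$. Put $\tilde c=\sqrt{g\tilde h}$. Primitives of the Coriolis force: $V,U$ with $V_x=\frac fgv$, $U_y=\frac fgu$ (at each time). Potential energies: $K=g(h+b-V)$, $L=g(h+b+U)$. Bicharacteristic cone: $P=(x,y,t_n+\tau)$, $\tau=\Delta t/2$; $Q_0=(x-\tilde u\tau,y-\tilde v\tau,t_n)$; for $\tilde t\in[t_n,t_n+\tau]$, with $s=t_n+\tau-\tilde t$: $\tilde Q_0=(x-\tilde us,\;y-\tilde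 vs,\;\tilde t)$ and $\tilde Q=\tilde Q(\tilde t,\theta)=(x-\tilde us+\tilde cs\cos\theta,\;y-\tilde vs+\tilde cs\sin\theta,\;\tilde t)$; $Q=Q(\theta)=\tilde Q|_{\tilde t=t_n}$. For the time-independent $b$, $b(P)=b(x,y)$, and $b(Q)$, $b_x(\tilde Q)$ etc. are evaluated at the spatial components. Exact integral equations (satisfied by solutions of the linearized system): $$h(P)=\frac1{2\pi}\int_0^{2\pi}\Big[h(Q)-\frac{\tilde c}g(u(Q)\cos\theta+v(Q)\sin\theta)\Big]d\theta-\frac1{2\pi}\int_{t_n}^{t_n+\tau}\frac1{t_n+\tau-\tilde t}\int_0^{2\pi}\frac{\tilde c}g(u(\tilde Q)\cos\theta+v(\tilde Q)\sin\theta)d\theta d\tilde t+\frac{\tilde c}{2\pi}\int_{t_n}^{t_n+\tau}\int_0^{2\pi}(b_x(\tilde Q)\cos\theta+b_y(\tilde Q)\sin\theta)d\theta d\tilde t-\frac{\tilde cf}{2\pi g}\int_{t_n}^{t_n+\tau}\int_0^{2\pi}(v(\tilde Q)\cos\theta-u(\tilde Q)\sin\theta)d\theta d\tilde t,$$ $$u(P)=\frac12u(Q_0)+\frac1{2\pi}\int_0^{2\pi}\Big[-\frac g{\tilde c}h(Q)\cos\theta+u(Q)\cos^2\theta+v(Q)\sin\theta\cos\theta\Big]d\theta-\frac g2\int_{t_n}^{t_n+\tau}(h_x(\tilde Q_0)+b_x(\tilde Q_0))d\tilde t-\frac g{2\pi}\int_{t_n}^{t_n+\tau}\int_0^{2\pi}(b_x(\tilde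 Q)\cos^2\theta+b_y(\tilde Q)\sin\theta\cos\theta)d\theta d\tilde t+\frac1{2\pi}\int_{t_n}^{t_n+\tau}\frac1{t_n+\tau-\tilde t}\int_0^{2\pi}(u(\tilde Q)\cos2\theta+v(\tilde Q)\sin2\theta)d\theta d\tilde t+\frac f2\int_{t_n}^{t_n+\tau}v(\tilde Q_0)d\tilde t+\frac f{2\pi}\int_{t_n}^{t_n+\tau}\int_0^{2\pi}(v(\tilde Q)\cos^2\theta-u(\tilde Q)\sin\theta\cos\theta)d\theta d\tilde t,$$ $$v(P)=\frac12v(Q_0)+\frac1{2\pi}\int_0^{2\pi}\Big[-\frac g{\tilde c}h(Q)\sin\theta+u(Q)\sin\theta\cos\theta+v(Q)\sin^2\theta\Big]d\theta-\frac g2\int_{t_n}^{t_n+\tau}(h_y(\tilde Q_0)+b_y(\tilde Q_0))d\tilde t-\frac g{2\pi}\int_{t_n}^{t_n+\tau}\int_0^{2\pi}(b_x(\tilde Q)\sin\theta\cos\theta+b_y(\tilde Q)\sin^2\theta)d\theta d\tilde t+\frac1{2\pi}\int_{t_n}^{t_n+\tau}\frac1{t_n+\tau-\tilde t}\int_0^{2\pi}(u(\tilde Q)\sin2\theta-v(\tilde Q)\cos2\theta)d\theta d\tilde t-\frac f2\int_{t_n}^{t_n+\tau}u(\tilde Q_0)d\tilde t+\frac f{2\pi}\int_{t_n}^{t_n+\tau}\int_0^{2\pi}(v(\tilde Q)\sin\theta\cos\theta-u(\tilde Q)\sin^2\theta)d\theta d\tilde t.$$ *)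

(* Defs.v *)
From Stdlib Require Import Reals.
From Coquelicot Require Import Coquelicot.
Open Scope R_scope.

(* A space-time point (x, y, t) is ((x, y), t) : R * R * R, so that [fst] is
   the projection onto the spatial components. *)

Definition partial_x (w : R * R * R -> R) (p : R * R * R) : R :=
  let '(x, y, t) := p in Derive (fun z => w (z, y, t)) x.

Definition partial_y (w : R * R * R -> R) (p : R * R * R) : R :=
  let '(x, y, t) := p in Derive (fun z => w (x, z, t)) y.

Definition partial_t (w : R * R * R -> R) (p : R * R * R) : R :=
  let '(x, y, t) := p in Derive (fun z => w (x, y, z)) t.

Definition partially_derivable (w : R * R * R -> R) (p : R * R * R) : Prop :=
  let '(x, y, t) := p in
  ex_derive (fun z => w (z, y, t)) x /\
  ex_derive (fun z => w (x, z, t)) y /\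
  ex_derive (fun z => w (x, y, z)) t.

Definition continuous_in (D : R * R * R -> Prop) (w : R * R * R -> R) : Prop :=
  forall p, D p -> continuous w p.

(* C^k on D: all partial derivatives up to order k exist and are jointly
   continuous on D (intended for open D). *)
Fixpoint Ck_in (D : R * R * R -> Prop) (k : nat) (w : R * R * R -> R) : Prop :=
  continuous_in D w /\
  match k with
  | O => True
  | S k' =>
      (forall p, D p -> partially_derivable w p) /\
      Ck_in D k' (partial_x w) /\
      Ck_in D k' (partial_y w) /\
      Ck_in D k' (partial_t w)
  end.

(* A time-independent quantity, regarded as a function of space-time. *)
Definition steady (b : R * R -> R) (p : R * R * R) : R := b (fst p).

(* [ht], [ut], [vt] are the constant background values of h, u, v. *)
Definition linearized_shallow_water (D : R * R * R -> Prop)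
    (ht ut vt g f : R) (b : R * R -> R) (h u v : R * R * R -> R) : Prop :=
  forall p, D p ->
    partial_t h p + ut * partial_x h p + vt * partial_y h p
      + ht * (partial_x u p + partial_y v p) = 0 /\
    partial_t u p + ut * partial_x u p + vt * partial_y u p + g * partial_x h p
      = - g * partial_x (steady b) p + f * v p /\
    partial_t v p + ut * partial_x v p + vt * partial_y v p + g * partial_y h p
      = - g * partial_y (steady b) p - f * u p.

(* The requirements V_x = W and U_y = W, at each time. They leave free an
   additive function of the other variables, which is only asked to be such
   that the primitive is continuous. *)
Definition x_primitive (D : R * R * R -> Prop) (V W : R * R * R -> R) : Prop :=
  continuous_in D V /\
  forall x y t, D (x, y, t) ->
    is_derive (fun z => V (z, y, t)) x (W (x, y, t)).

Definition y_primitive (D : R * R * R -> Prop) (U W : R * R * R -> R) : Prop :=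
  continuous_in D U /\
  forall x y t, D (x, y, t) ->
    is_derive (fun z => U (x, z, t)) y (W (x, y, t)).

(* Bicharacteristic cone with apex P: the point of its axis, resp. of its
   mantle in direction theta, at time t' (s is the time left to the apex). *)
Definition cone_axis (ut vt : R) (P : R * R * R) (t' : R) : R * R * R :=
  let '(x, y, T) := P in
  let s := T - t' in
  (x - ut * s, y - vt * s, t').

Definition cone_mantle (ut vt ct : R) (P : R * R * R) (t' theta : R)
    : R * R * R :=
  let '(x, y, T) := P in
  let s := T - t' in
  (x - ut * s + ct * s * cos theta, y - vt * s + ct * s * sin theta, t').

(* e(dt) = O(dt^2) as dt -> 0, dt > 0. *)
Definition O_square (e : R -> R) : Prop :=
  exists C : R, at_right 0 (fun dt => Rabs (e dt) <= C * dt ^ 2).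

(* Main.v *)
Require Import Defs.
From Stdlib Require Import Reals Lra.
From Coquelicot Require Import Coquelicot.
Open Scope R_scope.

(* Everything is expanded at the apex [P] of the cone. If [s] denotes the time left
   to the apex, a C^2 function satisfies [w (Qt) = w P + s * l theta + O(s^2)] with
   [l] affine in [cos theta] and [sin theta], uniformly in the apex near (x, y, tn);
   hence each integral over a circle is [m0 + s * m1 + O(s^2)] with explicit
   moments. Under the factor [1 / s] one has [m0 = 0], and the time integral is
   [dt / 2 * m1 + O(dt^2)]. Up to O(dt^2) each residual is thus dt times a linear
   combination of the derivatives at [P], which vanishes by the differential
   equations at [P] and [ct^2 = g * ht]. *)

(** The centre of expansion [P dt] moves with [dt], so the moments stay functions of [dt] and every
    constant has to hold on a whole neighbourhood of [(x, y, tn)]. The moments are not expanded any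
    further: the differential equations are applied at [P dt] itself, and once the remainders are
    collected an exact algebraic identity is left.

    The obstacle lies in [K] and [L]. The primitives [V] and [U] are differentiable along one axis
    and merely continuous otherwise, so they have no Taylor expansion. But [V] only ever meets the
    weight [cos theta] and [U] only [sin theta], and these weights annihilate the uncontrolled part,
    the trace of the primitive on a plane through the apex. Of that part only the circle integral
    obeys good bounds, not the integrand; this is why the estimates are finally phrased for circle
    integrals. *)

(** * Mean values, Lipschitz and Taylor bounds near a point *)

Definition box (p0 : R * R * R) (r : R) (p : R * R * R) : Prop :=
  let '(x, y, t) := p0 in let '(a, b, c) := p in
  Rabs (a - x) < r /\ Rabs (b - y) < r /\ Rabs (c - t) < r.

(** The l1 distance matches sums over axis-parallel steps, whereas [box] is the ball of the product
    uniform structure and contains those steps. *)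
Definition dist1 (p q : R * R * R) : R :=
  let '(a, b, c) := p in let '(a', b', c') := q in
  Rabs (a - a') + Rabs (b - b') + Rabs (c - c').

Lemma dist1_ge0 p q : 0 <= dist1 p q.
Proof.
  destruct p as [[a b] c], q as [[a' b'] c']; simpl.
  pose proof (Rabs_pos (a - a')); pose proof (Rabs_pos (b - b'));
  pose proof (Rabs_pos (c - c')); lra.
Qed.

Lemma box_le p0 r r' p : r <= r' -> box p0 r p -> box p0 r' p.
Proof.
  destruct p0 as [[x y] t], p as [[a b] c]; simpl; intros; lra.
Qed.

Lemma locally_box (p0 : R * R * R) (S : R * R * R -> Prop) :
  locally p0 S -> exists r, 0 < r /\ forall p, box p0 r p -> S p.
Proof.
  destruct p0 as [[x y] t]; intros [e He].
  exists e; split; [apply cond_pos |].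
  intros [[a b] c] [Ha [Hb Hc]]; apply He; repeat split; assumption.
Qed.

Lemma continuous_bounded_near (w : R * R * R -> R) (p0 : R * R * R) :
  continuous w p0 ->
  exists r M, 0 < r /\ 0 <= M /\ forall p, box p0 r p -> Rabs (w p) <= M.
Proof.
  intros Hw.
  destruct (locally_box p0 (fun p => ball (w p0) 1 (w p))) as [r [Hr H]].
  { apply Hw; exists (mkposreal 1 Rlt_0_1); easy. }
  exists r, (Rabs (w p0) + 1); repeat split;
    [assumption | pose proof (Rabs_pos (w p0)); lra |].
  intros p Hp; specialize (H p Hp).
  change (Rabs (w p - w p0) < 1) in H.
  replace (w p) with (w p0 + (w p - w p0)) by ring.
  eapply Rle_trans; [apply Rabs_triang |]; lra.
Qed.

Lemma between_near a a' xi :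
  Rmin a' a <= xi <= Rmax a' a ->
  Rabs (xi - a') <= Rabs (a - a') /\
  forall z r, Rabs (a - z) < r -> Rabs (a' - z) < r -> Rabs (xi - z) < r.
Proof.
  unfold Rmin, Rmax; destruct (Rle_dec a' a); intros H; split.
  - unfold Rabs; repeat destruct Rcase_abs; lra.
  - intros z r0 H1 H2; apply Rabs_def2 in H1, H2; apply Rabs_def1; lra.
  - unfold Rabs; repeat destruct Rcase_abs; lra.
  - intros z r0 H1 H2; apply Rabs_def2 in H1, H2; apply Rabs_def1; lra.
Qed.

Lemma mean_value (phi dphi : R -> R) (a a' : R) :
  (forall z, Rmin a' a <= z <= Rmax a' a -> is_derive phi z (dphi z)) ->
  exists xi, Rmin a' a <= xi <= Rmax a' a /\
    phi a - phi a' = dphi xi * (a - a').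
Proof.
  intros H; apply (MVT_gen phi a' a dphi).
  - intros z Hz; apply H; lra.
  - intros z Hz; apply continuity_pt_filterlim.
    apply (ex_derive_continuous phi); exists (dphi z); auto.
Qed.

(** With only partial derivatives at hand, the segment is replaced by three axis-parallel legs from
    [p] to [q], changing x, y and t in turn. Each leg has its own intermediate point, and none is
    farther from [q] than [p] is. *)
Lemma gradient_mean_value (w : R * R * R -> R) p0 r p q :
  (forall z, box p0 r z -> partially_derivable w z) ->
  box p0 r p -> box p0 r q ->
  exists p1 p2 p3,
    (box p0 r p1 /\ dist1 p1 q <= dist1 p q) /\
    (box p0 r p2 /\ dist1 p2 q <= dist1 p q) /\
    (box p0 r p3 /\ dist1 p3 q <= dist1 p q) /\
    w p - w q = partial_x w p1 * (fst (fst p) - fst (fst q))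
              + partial_y w p2 * (snd (fst p) - snd (fst q))
              + partial_t w p3 * (snd p - snd q).
Proof.
  destruct p0 as [[x y] t], p as [[a b] c], q as [[a' b'] c'].
  intros Hd [Ha [Hb Hc]] [Ha' [Hb' Hc']].
  assert (H1 : exists xi, Rmin a' a <= xi <= Rmax a' a /\
     w (a, b, c) - w (a', b, c) = partial_x w (xi, b, c) * (a - a')).
  { apply (mean_value (fun z => w (z, b, c)) (fun z => partial_x w (z, b, c))).
    intros z Hz; apply Derive_correct.
    destruct (between_near _ _ _ Hz) as [_ Hn].
    apply (Hd (z, b, c)); simpl; auto. }
  assert (H2 : exists xi, Rmin b' b <= xi <= Rmax b' b /\
     w (a', b, c) - w (a', b', c) = partial_y w (a', xi, c) * (b - b')).
  { apply (mean_value (fun z => w (a', z, c)) (fun z => partial_y w (a', z, c))).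
    intros z Hz; apply Derive_correct.
    destruct (between_near _ _ _ Hz) as [_ Hn].
    apply (Hd (a', z, c)); simpl; auto. }
  assert (H3 : exists xi, Rmin c' c <= xi <= Rmax c' c /\
     w (a', b', c) - w (a', b', c') = partial_t w (a', b', xi) * (c - c')).
  { apply (mean_value (fun z => w (a', b', z)) (fun z => partial_t w (a', b', z))).
    intros z Hz; apply Derive_correct.
    destruct (between_near _ _ _ Hz) as [_ Hn].
    apply (Hd (a', b', z)); simpl; auto. }
  destruct H1 as [x1 [B1 E1]], H2 as [x2 [B2 E2]], H3 as [x3 [B3 E3]].
  destruct (between_near _ _ _ B1) as [D1 N1], (between_near _ _ _ B2) as [D2 N2],
    (between_near _ _ _ B3) as [D3 N3].
  exists (x1, b, c), (a', x2, c), (a', b', x3); cbn [fst snd dist1 box].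
  pose proof (Rabs_pos (a - a')); pose proof (Rabs_pos (b - b'));
  pose proof (Rabs_pos (c - c')).
  rewrite !Rminus_eq_0, !Rabs_R0.
  repeat split; auto; lra.
Qed.

Definition lipschitz_near (p0 : R * R * R) (w : R * R * R -> R) : Prop :=
  exists r C, 0 < r /\ 0 <= C /\
    forall p q, box p0 r p -> box p0 r q -> Rabs (w p - w q) <= C * dist1 p q.

Lemma Ck_in_partials D k w :
  Ck_in D (S k) w ->
  (forall p, D p -> partially_derivable w p) /\
  Ck_in D k (partial_x w) /\ Ck_in D k (partial_y w) /\ Ck_in D k (partial_t w).
Proof. intros H; exact (proj2 H). Qed.

Lemma Ck_in_continuous D k w p : Ck_in D k w -> D p -> continuous w p.
Proof. destruct k; intros H Hp; apply (proj1 H); exact Hp. Qed.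

Lemma Ck_in_S D k w : Ck_in D (S k) w -> Ck_in D k w.
Proof.
  revert w; induction k as [|k IH]; intros w [H0 [H1 [H2 [H3 H4]]]].
  - split; auto.
  - split; [assumption |]; split; [assumption |].
    repeat split; apply IH; assumption.
Qed.

Lemma gradient_bound A B C M a b c dx dy dt :
  Rabs A <= M -> Rabs B <= M -> Rabs C <= M ->
  dx = Rabs a -> dy = Rabs b -> dt = Rabs c ->
  Rabs (A * a + B * b + C * c) <= M * (dx + dy + dt).
Proof.
  intros HA HB HC -> -> ->.
  eapply Rle_trans; [apply Rabs_triang |].
  eapply Rle_trans; [apply Rplus_le_compat_r, Rabs_triang |].
  rewrite !Rabs_mult.
  pose proof (Rmult_le_compat_r _ _ _ (Rabs_pos a) HA).
  pose proof (Rmult_le_compat_r _ _ _ (Rabs_pos b) HB).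
  pose proof (Rmult_le_compat_r _ _ _ (Rabs_pos c) HC).
  lra.
Qed.

Lemma dist1_coords p q :
  dist1 p q = Rabs (fst (fst p) - fst (fst q)) + Rabs (snd (fst p) - snd (fst q))
            + Rabs (snd p - snd q).
Proof. destruct p as [[a b] c], q as [[a' b'] c']; reflexivity. Qed.

Lemma C1_lipschitz_near D w p0 :
  open D -> D p0 -> Ck_in D 1 w -> lipschitz_near p0 w.
Proof.
  intros HD Hp0 Hw; apply Ck_in_partials in Hw as [Hd [Hx [Hy Ht]]].
  destruct (continuous_bounded_near _ _ (Ck_in_continuous _ _ _ _ Hx Hp0))
    as [r1 [M1 [R1 [P1 B1]]]].
  destruct (continuous_bounded_near _ _ (Ck_in_continuous _ _ _ _ Hy Hp0))
    as [r2 [M2 [R2 [P2 B2]]]].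
  destruct (continuous_bounded_near _ _ (Ck_in_continuous _ _ _ _ Ht Hp0))
    as [r3 [M3 [R3 [P3 B3]]]].
  destruct (locally_box p0 D (HD p0 Hp0)) as [r4 [R4 B4]].
  exists (Rmin (Rmin r1 r2) (Rmin r3 r4)), (M1 + M2 + M3).
  set (r := Rmin (Rmin r1 r2) (Rmin r3 r4)).
  assert (Hr : 0 < r /\ r <= r1 /\ r <= r2 /\ r <= r3 /\ r <= r4).
  { unfold r, Rmin; repeat destruct Rle_dec; lra. }
  destruct Hr as [Hr [Q1 [Q2 [Q3 Q4]]]].
  split; [assumption |]; split; [lra |]; intros p q Hp Hq.
  destruct (gradient_mean_value w p0 r p q) as
    [p1 [p2 [p3 [[I1 _] [[I2 _] [[I3 _] ->]]]]]]; auto.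
  { intros z Hz; apply Hd, B4; eapply box_le; eauto. }
  rewrite dist1_coords; apply gradient_bound; auto.
  - apply Rle_trans with M1; [apply B1; eapply box_le; eauto | lra].
  - apply Rle_trans with M2; [apply B2; eapply box_le; eauto | lra].
  - apply Rle_trans with M3; [apply B3; eapply box_le; eauto | lra].
Qed.

(* The base points [q] are confined to the vertical line through [p0], where
   the apices of the cones lie: the functions to which this is applied need not
   have a gradient elsewhere. *)
Definition taylor_near (p0 : R * R * R) (w wx wy wt : R * R * R -> R) : Prop :=
  exists r C, 0 < r /\ 0 <= C /\
    forall p q, box p0 r p -> box p0 r q -> fst q = fst p0 ->
    Rabs (w p - w q - (wx q * (fst (fst p) - fst (fst q))
                     + wy q * (snd (fst p) - snd (fst q))
                     + wt q * (snd p - snd q))) <= C * dist1 p q ^ 2.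

(** No second derivative is expanded: the first partials are Lipschitz, so moving each one from its
    mean value point to [q] costs a further factor [dist1 p q]. *)
Lemma C2_taylor_near D w p0 :
  open D -> D p0 -> Ck_in D 2 w ->
  taylor_near p0 w (partial_x w) (partial_y w) (partial_t w).
Proof.
  intros HD Hp0 Hw; apply Ck_in_partials in Hw as [Hd [Hx [Hy Ht]]].
  destruct (C1_lipschitz_near _ _ _ HD Hp0 Hx) as [r1 [M1 [R1 [P1 B1]]]].
  destruct (C1_lipschitz_near _ _ _ HD Hp0 Hy) as [r2 [M2 [R2 [P2 B2]]]].
  destruct (C1_lipschitz_near _ _ _ HD Hp0 Ht) as [r3 [M3 [R3 [P3 B3]]]].
  destruct (locally_box p0 D (HD p0 Hp0)) as [r4 [R4 B4]].
  exists (Rmin (Rmin r1 r2) (Rmin r3 r4)), (M1 + M2 + M3).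
  set (r := Rmin (Rmin r1 r2) (Rmin r3 r4)).
  assert (Hr : 0 < r /\ r <= r1 /\ r <= r2 /\ r <= r3 /\ r <= r4).
  { unfold r, Rmin; repeat destruct Rle_dec; lra. }
  destruct Hr as [Hr [Q1 [Q2 [Q3 Q4]]]].
  split; [assumption |]; split; [lra |]; intros p q Hp Hq _.
  destruct (gradient_mean_value w p0 r p q) as
    [p1 [p2 [p3 [[I1 D1] [[I2 D2] [[I3 D3] ->]]]]]]; auto.
  { intros z Hz; apply Hd, B4; eapply box_le; eauto. }
  pose proof (dist1_ge0 p q) as Hpos.
  replace (_ - _) with
    ((partial_x w p1 - partial_x w q) * (fst (fst p) - fst (fst q))
     + (partial_y w p2 - partial_y w q) * (snd (fst p) - snd (fst q))
     + (partial_t w p3 - partial_t w q) * (snd p - snd q)) by ring.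
  replace ((M1 + M2 + M3) * dist1 p q ^ 2) with
    ((M1 + M2 + M3) * dist1 p q * dist1 p q) by ring.
  rewrite (dist1_coords p q) at 2; apply gradient_bound; auto.
  - apply Rle_trans with (M1 * dist1 p1 q);
      [apply B1; eapply box_le; eauto | apply Rmult_le_compat; lra || apply dist1_ge0].
  - apply Rle_trans with (M2 * dist1 p2 q);
      [apply B2; eapply box_le; eauto | apply Rmult_le_compat; lra || apply dist1_ge0].
  - apply Rle_trans with (M3 * dist1 p3 q);
      [apply B3; eapply box_le; eauto | apply Rmult_le_compat; lra || apply dist1_ge0].
Qed.

Lemma lipschitz_near_bounded p0 w :
  lipschitz_near p0 w ->
  exists r M, 0 < r /\ 0 <= M /\ forall p, box p0 r p -> Rabs (w p) <= M.
Proof.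
  intros [r [C [Hr [HC H]]]].
  assert (H0 : box p0 r p0).
  { destruct p0 as [[x y] t]; simpl; rewrite !Rminus_eq_0, !Rabs_R0; auto. }
  exists (Rmin r 1), (C * 3 + Rabs (w p0)).
  assert (Hm : 0 < Rmin r 1 /\ Rmin r 1 <= r /\ Rmin r 1 <= 1)
    by (unfold Rmin; destruct Rle_dec; lra).
  destruct Hm as [Hm [Hm1 Hm2]].
  split; [assumption |].
  split; [pose proof (Rabs_pos (w p0)); lra |].
  intros p Hp; assert (Hd : dist1 p p0 <= 3).
  { revert Hp; destruct p0 as [[x y] t], p as [[a b] c]; simpl; lra. }
  replace (w p) with ((w p - w p0) + w p0) by ring.
  eapply Rle_trans; [apply Rabs_triang | apply Rplus_le_compat_r].
  eapply Rle_trans; [apply H; [eapply box_le; eauto | assumption] |].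
  apply Rmult_le_compat_l; assumption.
Qed.

(** * Regularity of the increments of [V] and [U] *)

(** Subtracting the trace on the plane through [x] removes the free additive function of y and t in
    [V]. What remains is the integral of [W] from [x], so it inherits the transversal regularity of
    [W]. *)
Definition x_increment (x : R) (V : R * R * R -> R) (p : R * R * R) : R :=
  V p - V (x, snd (fst p), snd p).

(** The gradient is [(W, 0, 0)] at base points on the vertical line, because the increment vanishes
    identically on the plane through [x]. The Taylor error is a difference of values of [W] times
    [a - x], hence quadratic. *)
Lemma x_increment_regular (V W : R * R * R -> R) (x y t r0 : R) :
  0 < r0 ->
  (forall a b c, box (x, y, t) r0 (a, b, c) ->
     is_derive (fun z => V (z, b, c)) a (W (a, b, c))) ->
  lipschitz_near (x, y, t) W ->
  lipschitz_near (x, y, t) (x_increment x V) /\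
  taylor_near (x, y, t) (x_increment x V) W (fun _ => 0) (fun _ => 0).
Proof.
  intros Hr0 HV HW.
  destruct (lipschitz_near_bounded _ _ HW) as [r1 [M [Hr1 [HM BM]]]].
  destruct HW as [r2 [C [Hr2 [HC LW]]]].
  set (r := Rmin (Rmin r0 r1) (Rmin r2 1)).
  assert (Hr : 0 < r /\ r <= r0 /\ r <= r1 /\ r <= r2 /\ r <= 1).
  { unfold r, Rmin; repeat destruct Rle_dec; lra. }
  destruct Hr as [Hr [Q0 [Q1 [Q2 Q3]]]].
  assert (Hx : Rabs (x - x) < r) by (rewrite Rminus_eq_0, Rabs_R0; exact Hr).
  split.
  - exists r, (M + C); split; [assumption |]; split; [lra |].
    intros [[a b] c] [[a' b'] c'] [Ha [Hb Hc]] [Ha' [Hb' Hc']].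
    unfold x_increment; cbn [fst snd dist1].
    destruct (mean_value (fun z => V (z, b, c)) (fun z => W (z, b, c)) a a')
      as [x1 [B1 E1]].
    { intros z Hz; apply HV, (box_le _ r); [assumption |].
      destruct (between_near _ _ _ Hz) as [_ Hn]; simpl; auto. }
    (* A transversal step is controlled by the mean value theorem in x for the difference of two
       lines: its derivative is a difference of values of [W], which is Lipschitz. The factor
       [a' - x] is at most 1 by the choice of [r]. *)
    destruct (mean_value (fun z => V (z, b, c) - V (z, b', c'))
      (fun z => W (z, b, c) - W (z, b', c')) a' x) as [x2 [B2 E2]].
    { intros z Hz; destruct (between_near _ _ _ Hz) as [_ Hn].
      apply @is_derive_minus; apply HV, (box_le _ r); simpl; auto. }
    destruct (between_near _ _ _ B1) as [_ N1], (between_near _ _ _ B2) as [_ N2].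
    replace (_ - _) with
      (W (x1, b, c) * (a - a')
       + (W (x2, b, c) - W (x2, b', c')) * (a' - x)) by lra.
    eapply Rle_trans; [apply Rabs_triang |]; rewrite !Rabs_mult.
    assert (K1 : Rabs (W (x1, b, c)) <= M)
      by (apply BM, (box_le _ r); simpl; auto).
    assert (K2 : Rabs (W (x2, b, c) - W (x2, b', c'))
                 <= C * dist1 (x2, b, c) (x2, b', c'))
      by (apply LW; apply (box_le _ r); simpl; auto).
    cbn [dist1] in K2; rewrite Rminus_eq_0, Rabs_R0 in K2.
    pose proof (Rabs_pos (a - a')); pose proof (Rabs_pos (b - b'));
    pose proof (Rabs_pos (c - c')).
    pose proof (Rmult_le_compat_r _ _ _ (Rabs_pos (a - a')) K1) as K1'.
    assert (K2' : Rabs (W (x2, b, c) - W (x2, b', c')) * Rabs (a' - x)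
                  <= C * (0 + Rabs (b - b') + Rabs (c - c')) * 1).
    { apply Rmult_le_compat; auto using Rabs_pos; lra. }
    assert (0 <= C * Rabs (a - a')) by (apply Rmult_le_pos; lra).
    assert (0 <= M * (Rabs (b - b') + Rabs (c - c'))) by (apply Rmult_le_pos; lra).
    lra.
  - exists r, C; split; [assumption |]; split; [assumption |].
    intros [[a b] c] [[a' b'] c'] [Ha [Hb Hc]] [Ha' [Hb' Hc']] Eq.
    injection Eq; intros -> ->.
    unfold x_increment; cbn [fst snd].
    destruct (mean_value (fun z => V (z, b, c)) (fun z => W (z, b, c)) a x)
      as [x1 [B1 E1]].
    { intros z Hz; apply HV, (box_le _ r); [assumption |].
      destruct (between_near _ _ _ Hz) as [_ Hn]; simpl; auto. }
    destruct (between_near _ _ _ B1) as [D1 N1].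
    replace (_ - _) with ((W (x1, b, c) - W (x, y, c')) * (a - x)) by lra.
    rewrite Rabs_mult.
    assert (K : Rabs (W (x1, b, c) - W (x, y, c'))
                 <= C * dist1 (x1, b, c) (x, y, c'))
      by (apply LW; apply (box_le _ r); simpl; auto).
    assert (L : dist1 (x1, b, c) (x, y, c') <= dist1 (a, b, c) (x, y, c'))
      by (simpl; lra).
    pose proof (dist1_ge0 (x1, b, c) (x, y, c')).
    apply Rle_trans with
      (C * dist1 (a, b, c) (x, y, c') * dist1 (a, b, c) (x, y, c')); [| simpl; lra].
    apply Rmult_le_compat; auto using Rabs_pos.
    + apply Rle_trans with (1 := K); apply Rmult_le_compat_l; assumption.
    + simpl; pose proof (Rabs_pos (b - y)); pose proof (Rabs_pos (c - c')); lra.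
Qed.

(** Exchanging the horizontal axes turns y-primitives into x-primitives, so the estimates for [U]
    are those for [V]. *)
Definition swap_xy (p : R * R * R) : R * R * R :=
  (snd (fst p), fst (fst p), snd p).

Lemma box_swap_xy p0 r p : box p0 r p -> box (swap_xy p0) r (swap_xy p).
Proof. destruct p0 as [[x y] t], p as [[a b] c]; simpl; tauto. Qed.

Lemma dist1_swap_xy p q : dist1 (swap_xy p) (swap_xy q) = dist1 p q.
Proof. destruct p as [[a b] c], q as [[a' b'] c']; simpl; ring. Qed.

Lemma lipschitz_near_swap_xy p0 w :
  lipschitz_near p0 w -> lipschitz_near (swap_xy p0) (fun p => w (swap_xy p)).
Proof.
  intros [r [C [Hr [HC H]]]]; exists r, C; split; [assumption |].
  split; [assumption |]; intros p q Hp Hq; rewrite <- dist1_swap_xy.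
  apply box_swap_xy in Hp, Hq.
  apply H; destruct p0 as [[x y] t]; assumption.
Qed.

Lemma taylor_near_swap_xy p0 w wx wy wt :
  taylor_near p0 w wx wy wt ->
  taylor_near (swap_xy p0) (fun p => w (swap_xy p)) (fun p => wy (swap_xy p))
    (fun p => wx (swap_xy p)) (fun p => wt (swap_xy p)).
Proof.
  intros [r [C [Hr [HC H]]]]; exists r, C; split; [assumption |].
  split; [assumption |]; intros p q Hp Hq Eq; rewrite <- dist1_swap_xy.
  apply box_swap_xy in Hp, Hq.
  specialize (H (swap_xy p) (swap_xy q)).
  destruct p0 as [[x y] t], p as [[a b] c], q as [[a' b'] c'].
  specialize (H Hp Hq); injection Eq; intros -> ->.
  specialize (H eq_refl); cbn [swap_xy fst snd] in H |- *.
  eapply Rle_trans; [right | exact H].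
  f_equal; ring.
Qed.

Definition y_increment (y : R) (U : R * R * R -> R) (p : R * R * R) : R :=
  U p - U (fst (fst p), y, snd p).

Lemma lipschitz_near_ext p0 w w' :
  (forall p, w p = w' p) -> lipschitz_near p0 w -> lipschitz_near p0 w'.
Proof.
  intros E [r [C [Hr [HC H]]]]; exists r, C; repeat split; auto.
  intros p q; rewrite <- !E; apply H.
Qed.

Lemma taylor_near_ext p0 w w' wx wx' wy wy' wt wt' :
  (forall p, w p = w' p) -> (forall p, wx p = wx' p) ->
  (forall p, wy p = wy' p) -> (forall p, wt p = wt' p) ->
  taylor_near p0 w wx wy wt -> taylor_near p0 w' wx' wy' wt'.
Proof.
  intros E Ex Ey Et [r [C [Hr [HC H]]]]; exists r, C; repeat split; auto.
  intros p q; rewrite <- !E, <- Ex, <- Ey, <- Et; apply H.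
Qed.

Lemma y_increment_regular (U W : R * R * R -> R) (x y t r0 : R) :
  0 < r0 ->
  (forall a b c, box (x, y, t) r0 (a, b, c) ->
     is_derive (fun z => U (a, z, c)) b (W (a, b, c))) ->
  lipschitz_near (x, y, t) W ->
  lipschitz_near (x, y, t) (y_increment y U) /\
  taylor_near (x, y, t) (y_increment y U) (fun _ => 0) W (fun _ => 0).
Proof.
  intros Hr0 HU HW.
  destruct (x_increment_regular (fun p => U (swap_xy p)) (fun p => W (swap_xy p))
              y x t r0) as [HL HT]; auto.
  - intros a b c Hb; apply (HU b a c), (box_swap_xy (y, x, t) r0 (a, b, c) Hb).
  - exact (lipschitz_near_swap_xy (x, y, t) W HW).
  - split.
    + apply lipschitz_near_swap_xy in HL; revert HL.
      apply lipschitz_near_ext; intros [[a b] c]; reflexivity.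
    + apply taylor_near_swap_xy in HT; revert HT.
      apply taylor_near_ext; intros [[a b] c]; reflexivity.
Qed.

(** * Lipschitz bounds and smallness of the cone *)

Lemma lipschitz_continuous (phi : R -> R) (a C d : R) :
  0 < d -> (forall z, Rabs (z - a) < d -> Rabs (phi z - phi a) <= C * Rabs (z - a)) ->
  continuous phi a.
Proof.
  intros Hd H; apply filterlim_locally; intros eps.
  (* The sign of [C] is unknown; adding 1 makes the divisor positive. *)
  set (K := Rabs C + 1).
  assert (HK : 0 < K) by (unfold K; pose proof (Rabs_pos C); lra).
  assert (He : 0 < Rmin d (eps / K)).
  { apply Rmin_pos; [assumption | apply Rdiv_lt_0_compat; [apply cond_pos | assumption]]. }
  exists (mkposreal _ He); intros z Hz.
  change (Rabs (z - a) < Rmin d (eps / K)) in Hz.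
  change (Rabs (phi z - phi a) < eps).
  assert (H1 : Rabs (z - a) < d) by (eapply Rlt_le_trans; [exact Hz | apply Rmin_l]).
  assert (H2 : Rabs (z - a) < eps / K) by (eapply Rlt_le_trans; [exact Hz | apply Rmin_r]).
  apply Rle_lt_trans with (1 := H z H1).
  apply Rle_lt_trans with (K * Rabs (z - a)).
  - apply Rmult_le_compat_r; [apply Rabs_pos |].
    unfold K; pose proof (Rle_abs C); lra.
  - apply Rmult_lt_reg_r with (/ K); [apply Rinv_0_lt_compat; assumption |].
    replace (K * Rabs (z - a) * / K) with (Rabs (z - a)) by (field; lra); exact H2.
Qed.

Lemma cos_lipschitz a b : Rabs (cos a - cos b) <= Rabs (a - b).
Proof.
  destruct (mean_value cos (fun z => - sin z) a b) as [c [_ ->]].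
  { intros z _; auto_derive; [trivial | ring]. }
  rewrite Rabs_mult, Rabs_Ropp; pose proof (SIN_bound c).
  rewrite <- (Rmult_1_l (Rabs (a - b))) at 2.
  apply Rmult_le_compat_r; [apply Rabs_pos | apply Rabs_le; lra].
Qed.

Lemma sin_lipschitz a b : Rabs (sin a - sin b) <= Rabs (a - b).
Proof.
  destruct (mean_value sin cos a b) as [c [_ ->]].
  { intros z _; auto_derive; [trivial | ring]. }
  rewrite Rabs_mult; pose proof (COS_bound c).
  rewrite <- (Rmult_1_l (Rabs (a - b))) at 2.
  apply Rmult_le_compat_r; [apply Rabs_pos | apply Rabs_le; lra].
Qed.

Lemma cone_mantle_apex ut vt ct x y T theta :
  cone_mantle ut vt ct (x, y, T) T theta = (x, y, T).
Proof. unfold cone_mantle; repeat f_equal; ring. Qed.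

(** For fixed [theta] the mantle point runs along a straight line, so its displacement is linear in
    [t1 - t2]. The constant bounds its velocity: 1 for time, [Rabs ut] and [Rabs vt] for the drift,
    one [Rabs ct] each for [cos] and [sin]. *)
Lemma cone_mantle_time_lipschitz ut vt ct P t1 t2 theta :
  dist1 (cone_mantle ut vt ct P t1 theta) (cone_mantle ut vt ct P t2 theta)
  <= (1 + Rabs ut + Rabs vt + 2 * Rabs ct) * Rabs (t1 - t2).
Proof.
  destruct P as [[x y] T]; cbn [cone_mantle dist1].
  match goal with |- Rabs ?a + Rabs ?b + _ <= _ =>
    replace a with ((ut - ct * cos theta) * (t1 - t2)) by ring;
    replace b with ((vt - ct * sin theta) * (t1 - t2)) by ring end.
  rewrite !Rabs_mult.
  assert (Hc : Rabs (ut - ct * cos theta) <= Rabs ut + Rabs ct).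
  { eapply Rle_trans; [apply Rabs_triang |]; rewrite Rabs_Ropp, Rabs_mult.
    pose proof (COS_bound theta).
    assert (Rabs (cos theta) <= 1) by (apply Rabs_le; lra).
    pose proof (Rmult_le_compat_l (Rabs ct) _ _ (Rabs_pos ct) H0); lra. }
  assert (Hs : Rabs (vt - ct * sin theta) <= Rabs vt + Rabs ct).
  { eapply Rle_trans; [apply Rabs_triang |]; rewrite Rabs_Ropp, Rabs_mult.
    pose proof (SIN_bound theta).
    assert (Rabs (sin theta) <= 1) by (apply Rabs_le; lra).
    pose proof (Rmult_le_compat_l (Rabs ct) _ _ (Rabs_pos ct) H0); lra. }
  pose proof (Rmult_le_compat_r _ _ _ (Rabs_pos (t1 - t2)) Hc).
  pose proof (Rmult_le_compat_r _ _ _ (Rabs_pos (t1 - t2)) Hs).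
  lra.
Qed.

Lemma cone_mantle_angle_lipschitz ut vt ct x y T t theta1 theta2 :
  dist1 (cone_mantle ut vt ct (x, y, T) t theta1)
        (cone_mantle ut vt ct (x, y, T) t theta2)
  <= 2 * Rabs (ct * (T - t)) * Rabs (theta1 - theta2).
Proof.
  cbn [cone_mantle dist1].
  match goal with |- Rabs ?a + Rabs ?b + Rabs ?c <= _ =>
    replace a with (ct * (T - t) * (cos theta1 - cos theta2)) by ring;
    replace b with (ct * (T - t) * (sin theta1 - sin theta2)) by ring;
    replace c with 0 by ring end.
  rewrite Rabs_R0, (Rabs_mult _ (cos _ - _)), (Rabs_mult _ (sin _ - _)).
  pose proof (Rmult_le_compat_l _ _ _ (Rabs_pos (ct * (T - t))) (cos_lipschitz theta1 theta2)).
  pose proof (Rmult_le_compat_l _ _ _ (Rabs_pos (ct * (T - t))) (sin_lipschitz theta1 theta2)).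
  lra.
Qed.

Lemma at_right_0_lt e : 0 < e -> at_right 0 (fun dt => 0 < dt < e).
Proof.
  intros He; exists (mkposreal e He); intros dt Hb Hdt.
  change (Rabs (dt - 0) < e) in Hb; rewrite Rminus_0_r in Hb.
  apply Rabs_def2 in Hb; lra.
Qed.

(** The time window reaches below [tn], although the integrals start there, because continuity at
    the lower limit is two-sided. A time in the window may thus precede the apex by a full [dt],
    whence the bound [r / B] on [dt]. *)
Lemma cone_mantle_in_box ut vt ct x y tn r :
  0 < r ->
  at_right 0 (fun dt => forall t theta, Rabs (t - tn) <= dt / 2 ->
    box (x, y, tn) r (cone_mantle ut vt ct (x, y, tn + dt / 2) t theta)).
Proof.
  intros Hr; set (B := 1 + Rabs ut + Rabs vt + 2 * Rabs ct).
  assert (HB : 1 <= B).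
  { unfold B; pose proof (Rabs_pos ut); pose proof (Rabs_pos vt);
    pose proof (Rabs_pos ct); lra. }
  generalize (at_right_0_lt (r / B)); intros H.
  eapply filter_imp; [| apply H, Rdiv_lt_0_compat; lra].
  intros dt [H0 H1] t theta Ht.
  assert (Hs : Rabs (t - (tn + dt / 2)) <= dt).
  { apply Rabs_le; revert Ht; unfold Rabs; destruct Rcase_abs; lra. }
  pose proof (cone_mantle_time_lipschitz ut vt ct (x, y, tn + dt / 2)
    t (tn + dt / 2) theta) as Hd.
  rewrite cone_mantle_apex in Hd; fold B in Hd.
  assert (Hd2 : B * Rabs (t - (tn + dt / 2)) <= B * dt)
    by (apply Rmult_le_compat_l; lra).
  assert (Hd3 : B * dt < r).
  { apply Rmult_lt_reg_r with (/ B); [apply Rinv_0_lt_compat; lra |].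
    replace (B * dt * / B) with dt by (field; lra); exact H1. }
  assert (Hd4 : dt < r).
  { apply Rle_lt_trans with (2 := Hd3); rewrite <- (Rmult_1_l dt) at 1.
    apply Rmult_le_compat_r; lra. }
  cbn [cone_mantle dist1] in Hd; cbn [cone_mantle box].
  match type of Hd with ?a + ?b + ?c <= _ =>
    pose proof (Rabs_pos (t - (tn + dt / 2)));
    assert (0 <= a) by apply Rabs_pos; assert (0 <= b) by apply Rabs_pos end.
  repeat split; lra.
Qed.

(** * Pointwise expansion on the mantle *)

(** Continuity in [theta] yields the circle integrals; the bound uniform in [theta] makes them
    Lipschitz in time. *)
Definition cone_lipschitz (tn : R) (E : R -> R -> R -> R) : Prop :=
  exists C, at_right 0 (fun dt => forall t, Rabs (t - tn) <= dt / 2 ->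
    (forall theta, continuous (E dt t) theta) /\
    forall t' theta, Rabs (t' - tn) <= dt / 2 ->
      Rabs (E dt t' theta - E dt t theta) <= C * Rabs (t' - t)).

Definition cone_expands (tn : R) (E : R -> R -> R -> R) (e0 e1 : R -> R -> R) : Prop :=
  exists C, at_right 0 (fun dt => forall t theta, Rabs (t - tn) <= dt / 2 ->
    Rabs (E dt t theta - (e0 dt theta + (tn + dt / 2 - t) * e1 dt theta))
    <= C * (tn + dt / 2 - t) ^ 2).

Lemma cone_lipschitz_near ut vt ct x y tn w :
  lipschitz_near (x, y, tn) w ->
  cone_lipschitz tn
    (fun dt t theta => w (cone_mantle ut vt ct (x, y, tn + dt / 2) t theta)).
Proof.
  intros [r [C [Hr [HC H]]]].
  exists (C * (1 + Rabs ut + Rabs vt + 2 * Rabs ct)).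
  eapply filter_imp; [| apply (cone_mantle_in_box ut vt ct x y tn r Hr)].
  intros dt Hb t Ht; split.
  - intros theta.
    apply lipschitz_continuous with
      (C := C * (2 * Rabs (ct * (tn + dt / 2 - t)))) (1 := Rlt_0_1).
    intros z _; eapply Rle_trans; [apply H; apply Hb; assumption |].
    rewrite Rmult_assoc; apply Rmult_le_compat_l; [assumption |].
    apply cone_mantle_angle_lipschitz.
  - intros t' theta Ht'; eapply Rle_trans; [apply H; apply Hb; assumption |].
    rewrite Rmult_assoc; apply Rmult_le_compat_l; [assumption |].
    apply cone_mantle_time_lipschitz.
Qed.

(** From the apex, the mantle point is displaced by s times [(- ut + ct * cos theta, - vt + ct * sin
    theta, -1)]. Pairing with the gradient gives minus the derivative along the flow plus [ct] times
    the derivative in direction [theta]. The [dist1] length is at most [B * s], whence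
    [C * B ^ 2]. *)
Lemma cone_expands_taylor ut vt ct x y tn w wx wy wt :
  taylor_near (x, y, tn) w wx wy wt ->
  cone_expands tn
    (fun dt t theta => w (cone_mantle ut vt ct (x, y, tn + dt / 2) t theta))
    (fun dt _ => w (x, y, tn + dt / 2))
    (fun dt theta => let p := (x, y, tn + dt / 2) in
       - (ut * wx p + vt * wy p + wt p)
       + ct * (wx p * cos theta + wy p * sin theta)).
Proof.
  intros [r [C [Hr [HC H]]]].
  set (B := 1 + Rabs ut + Rabs vt + 2 * Rabs ct).
  exists (C * B ^ 2).
  eapply filter_imp;
    [| exact (filter_and _ _ (cone_mantle_in_box ut vt ct x y tn r Hr)
                (at_right_0_lt 1 Rlt_0_1))].
  intros dt [Hb Hdt] t theta Ht.
  set (p := (x, y, tn + dt / 2)).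
  assert (Hp : box (x, y, tn) r p).
  { unfold p; rewrite <- (cone_mantle_apex ut vt ct x y (tn + dt / 2) 0); apply Hb.
    apply Rabs_le; lra. }
  specialize (H _ _ (Hb t theta Ht) Hp eq_refl).
  pose proof (cone_mantle_time_lipschitz ut vt ct p t (tn + dt / 2) theta) as Hd.
  unfold p in Hd at 2; rewrite cone_mantle_apex in Hd; fold p B in Hd.
  pose proof (dist1_ge0 (cone_mantle ut vt ct p t theta) p) as Hd0.
  eapply Rle_trans; [| eapply Rle_trans; [exact H |]].
  - right; f_equal; cbn [cone_mantle fst snd p]; ring.
  - replace (C * B ^ 2 * (tn + dt / 2 - t) ^ 2)
      with (C * (B * Rabs (t - (tn + dt / 2))) ^ 2).
    + apply Rmult_le_compat_l, pow_incr; auto.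
    + rewrite Rpow_mult_distr, pow2_abs; ring.
Qed.

Lemma cone_lipschitz_mult tn E (phi : R -> R) (M : R) :
  (forall theta, continuous phi theta) -> (forall theta, Rabs (phi theta) <= M) ->
  cone_lipschitz tn E ->
  cone_lipschitz tn (fun dt t theta => E dt t theta * phi theta).
Proof.
  intros Hc HM [C HC]; exists (Rabs C * M).
  eapply filter_imp; [| exact HC].
  intros dt H t Ht; specialize (H t Ht); split.
  - intros theta; apply (continuous_mult (K := R_AbsRing) (E dt t) phi); [apply H | apply Hc].
  - intros t' theta Ht'; rewrite <- Rmult_minus_distr_r, Rabs_mult.
    replace (Rabs C * M * Rabs (t' - t)) with (Rabs C * Rabs (t' - t) * M) by ring.
    apply Rmult_le_compat; auto using Rabs_pos.
    eapply Rle_trans; [apply H; assumption |].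
    apply Rmult_le_compat_r; [apply Rabs_pos | apply Rle_abs].
Qed.

Lemma cone_expands_mult tn E e0 e1 (phi : R -> R) (M : R) :
  (forall theta, Rabs (phi theta) <= M) ->
  cone_expands tn E e0 e1 ->
  cone_expands tn (fun dt t theta => E dt t theta * phi theta)
    (fun dt theta => e0 dt theta * phi theta)
    (fun dt theta => e1 dt theta * phi theta).
Proof.
  intros HM [C HC]; exists (C * M).
  eapply filter_imp; [| exact HC].
  intros dt H t theta Ht; specialize (H t theta Ht).
  match type of H with Rabs ?a <= ?b =>
    replace (_ - _) with (a * phi theta) by ring;
    replace (C * M * _) with (b * M) by ring end.
  rewrite Rabs_mult; apply Rmult_le_compat; auto using Rabs_pos.
Qed.

(** * Calculus of O(dt^2) and integrals of nearly constant functions *)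

Lemma O_square_ext e e' :
  at_right 0 (fun dt => e dt = e' dt) -> O_square e -> O_square e'.
Proof.
  intros H [C HC]; exists C; eapply filter_imp; [| exact (filter_and _ _ H HC)].
  intros dt [<- H']; exact H'.
Qed.

Lemma O_square_plus e e' :
  O_square e -> O_square e' -> O_square (fun dt => e dt + e' dt).
Proof.
  intros [C HC] [C' HC']; exists (C + C').
  eapply filter_imp; [| exact (filter_and _ _ HC HC')].
  intros dt [H H']; eapply Rle_trans; [apply Rabs_triang |]; lra.
Qed.

Lemma O_square_scal k e : O_square e -> O_square (fun dt => k * e dt).
Proof.
  intros [C HC]; exists (Rabs k * C); eapply filter_imp; [| exact HC].
  intros dt H; rewrite Rabs_mult, Rmult_assoc.
  apply Rmult_le_compat_l; [apply Rabs_pos | exact H].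
Qed.

(** Nothing is asked of [F] at [T], where the weight [1 / s] is meaningless. The function [G] is
    [F - A], set to 0 from [T] on; the bound on [F] makes it continuous there, and the altered value
    at an endpoint does not change the integral. *)
Lemma RInt_near_constant (F : R -> R) (a T A C : R) :
  a < T ->
  (forall t, a <= t < T -> continuous F t) ->
  (forall t, a <= t < T -> Rabs (F t - A) <= C * (T - t)) ->
  Rabs (RInt F a T - A * (T - a)) <= C * (T - a) ^ 2.
Proof.
  intros HaT Hc HF.
  assert (HC : 0 <= C).
  { assert (H := HF a (conj (Rle_refl a) HaT)).
    pose proof (Rabs_pos (F a - A)).
    apply Rmult_le_reg_r with (T - a); lra. }
  set (G := fun t => (if Rlt_dec t T then F t else A) - A).
  assert (GB : forall t, a <= t <= T -> Rabs (G t) <= C * (T - t)).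
  { intros t Ht; unfold G; destruct Rlt_dec; [apply HF; lra |].
    rewrite Rminus_eq_0, Rabs_R0; apply Rmult_le_pos; lra. }
  assert (Gc : forall t, a <= t <= T -> continuous G t).
  { intros t Ht; apply @continuous_minus; [| apply continuous_const].
    destruct (Rlt_dec t T) as [L | L].
    - apply (continuous_ext_loc _ F); [| apply Hc; lra].
      apply (filter_imp (fun z => z < T)); [| apply open_lt; exact L].
      intros z Hz; destruct Rlt_dec; [reflexivity | contradiction].
    - replace t with T by lra.
      apply lipschitz_continuous with (C := C) (d := T - a); [lra |].
      intros z Hz; destruct (Rlt_dec T T) as [N | _]; [lra |].
      apply Rabs_def2 in Hz; destruct (Rlt_dec z T).
      + rewrite (Rabs_left (z - T)) by lra.
        replace (- (z - T)) with (T - z) by ring; apply HF; lra.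
      + rewrite Rminus_eq_0, Rabs_R0; apply Rmult_le_pos; auto using Rabs_pos. }
  assert (Gi : ex_RInt G a T).
  { apply @ex_RInt_continuous; intros z; rewrite Rmin_left, Rmax_right by lra; apply Gc. }
  assert (E : RInt F a T = RInt G a T + A * (T - a)).
  { apply is_RInt_unique.
    apply (is_RInt_ext (fun t => plus (G t) A)).
    - intros t; rewrite Rmin_left, Rmax_right by lra; intros Ht.
      unfold G; destruct Rlt_dec; [| lra]; change (@eq R (F t - A + A) (F t)); ring.
    - replace (A * (T - a)) with (scal (T - a) A) by apply Rmult_comm.
      apply @is_RInt_plus; [| apply @is_RInt_const].
      apply (RInt_correct (V := R_CompleteNormedModule) G), Gi. }
  rewrite E, Rplus_minus_r.
  replace (C * (T - a) ^ 2) with ((T - a) * (C * (T - a))) by ring.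
  apply abs_RInt_le_const; [lra | assumption |].
  intros t Ht; eapply Rle_trans; [apply GB, Ht |].
  apply Rmult_le_compat_l; lra.
Qed.

(** * Circle integrals *)

Lemma cone_lipschitz_ex_RInt tn E :
  cone_lipschitz tn E ->
  at_right 0 (fun dt => forall t, Rabs (t - tn) <= dt / 2 ->
    ex_RInt (E dt t) 0 (2 * PI)).
Proof.
  intros [C HC]; eapply filter_imp; [| exact HC].
  intros dt H t Ht; apply @ex_RInt_continuous; intros z _; apply (H t Ht).
Qed.

Lemma circle_RInt_bound (f : R -> R) (l M : R) :
  (forall theta, Rabs (f theta) <= M) -> is_RInt f 0 (2 * PI) l ->
  Rabs l <= 2 * PI * M.
Proof.
  intros HM Hf; pose proof PI_RGT_0.
  replace (2 * PI * M) with ((2 * PI - 0) * M) by ring.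
  apply (norm_RInt_le_const f 0 (2 * PI) l M); auto; lra.
Qed.

Lemma cone_lipschitz_RInt tn E :
  cone_lipschitz tn E ->
  exists C, at_right 0 (fun dt => forall t t',
    Rabs (t - tn) <= dt / 2 -> Rabs (t' - tn) <= dt / 2 ->
    Rabs (RInt (E dt t') 0 (2 * PI) - RInt (E dt t) 0 (2 * PI))
    <= C * Rabs (t' - t)).
Proof.
  intros HE; pose proof (cone_lipschitz_ex_RInt _ _ HE) as HI.
  destruct HE as [C HC]; exists (2 * PI * C).
  eapply filter_imp; [| exact (filter_and _ _ HC HI)].
  intros dt [H I] t t' Ht Ht'; rewrite Rmult_assoc.
  apply circle_RInt_bound with (f := fun theta => E dt t' theta - E dt t theta).
  - intros theta; apply H; assumption.
  - apply @is_RInt_minus; apply @RInt_correct; auto.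
Qed.

Lemma cone_lipschitz_RInt_continuous tn E :
  cone_lipschitz tn E ->
  at_right 0 (fun dt => forall t, tn <= t < tn + dt / 2 ->
    continuous (fun t => RInt (E dt t) 0 (2 * PI)) t).
Proof.
  intros HE; destruct (cone_lipschitz_RInt _ _ HE) as [C HC].
  eapply filter_imp; [| exact HC].
  intros dt H t Ht.
  apply lipschitz_continuous with (C := C) (d := tn + dt / 2 - t); [lra |].
  intros z Hz; apply Rabs_def2 in Hz; apply H; apply Rabs_le; lra.
Qed.

Lemma cone_expands_RInt tn E e0 e1 (m0 m1 : R -> R) :
  cone_lipschitz tn E -> cone_expands tn E e0 e1 ->
  (forall dt, is_RInt (e0 dt) 0 (2 * PI) (m0 dt)) ->
  (forall dt, is_RInt (e1 dt) 0 (2 * PI) (m1 dt)) ->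
  exists C, at_right 0 (fun dt => forall t, Rabs (t - tn) <= dt / 2 ->
    Rabs (RInt (E dt t) 0 (2 * PI) - (m0 dt + (tn + dt / 2 - t) * m1 dt))
    <= C * (tn + dt / 2 - t) ^ 2).
Proof.
  intros HL [C HC] H0 H1; pose proof (cone_lipschitz_ex_RInt _ _ HL) as HI.
  exists (2 * PI * C).
  eapply filter_imp; [| exact (filter_and _ _ HC HI)].
  intros dt [H I] t Ht; rewrite Rmult_assoc.
  apply circle_RInt_bound with
    (f := fun theta => E dt t theta - (e0 dt theta + (tn + dt / 2 - t) * e1 dt theta)).
  - intros theta; apply H; assumption.
  - apply @is_RInt_minus; [apply @RInt_correct; auto |].
    apply @is_RInt_plus; [apply H0 | apply @is_RInt_scal, H1].
Qed.

(* [E dt t] is the integrand on the circle at time [t] of the cone whose apex is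
   at time [tn + dt / 2]; its integral is [m0 dt + s * m1 dt + O(s^2)] with [s]
   the time left to the apex. The Lipschitz bound in [t] is there because
   Coquelicot's [RInt] has a junk value on functions that are not integrable,
   so that the time integrals must be shown to exist. *)
Definition cone_average (tn : R) (E : R -> R -> R -> R) (m0 m1 : R -> R) : Prop :=
  exists C, at_right 0 (fun dt => forall t, Rabs (t - tn) <= dt / 2 ->
    ex_RInt (E dt t) 0 (2 * PI) /\
    Rabs (RInt (E dt t) 0 (2 * PI) - (m0 dt + (tn + dt / 2 - t) * m1 dt))
      <= C * (tn + dt / 2 - t) ^ 2 /\
    forall t', Rabs (t' - tn) <= dt / 2 ->
      Rabs (RInt (E dt t') 0 (2 * PI) - RInt (E dt t) 0 (2 * PI))
      <= C * Rabs (t' - t)).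

Lemma cone_average_expands tn E e0 e1 (m0 m1 : R -> R) :
  cone_lipschitz tn E -> cone_expands tn E e0 e1 ->
  (forall dt, is_RInt (e0 dt) 0 (2 * PI) (m0 dt)) ->
  (forall dt, is_RInt (e1 dt) 0 (2 * PI) (m1 dt)) ->
  cone_average tn E m0 m1.
Proof.
  intros HL HE H0 H1.
  destruct (cone_expands_RInt _ _ _ _ _ _ HL HE H0 H1) as [C HC].
  destruct (cone_lipschitz_RInt _ _ HL) as [C' HC'].
  pose proof (cone_lipschitz_ex_RInt _ _ HL) as HI.
  exists (Rmax C C'); eapply filter_imp;
    [| exact (filter_and _ _ (filter_and _ _ HC HC') HI)].
  intros dt [[K K'] I] t Ht; repeat split.
  - apply I; assumption.
  - apply Rle_trans with (1 := K t Ht).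
    apply Rmult_le_compat_r; [apply pow2_ge_0 | apply Rmax_l].
  - intros t' Ht'; apply Rle_trans with (1 := K' t t' Ht Ht').
    apply Rmult_le_compat_r; [apply Rabs_pos | apply Rmax_r].
Qed.

Lemma cone_average_ext tn E F m0 n0 m1 n1 :
  cone_average tn E m0 m1 ->
  (forall dt t theta, E dt t theta = F dt t theta) ->
  (forall dt, m0 dt = n0 dt) -> (forall dt, m1 dt = n1 dt) ->
  cone_average tn F n0 n1.
Proof.
  intros [C HC] EF E0 E1; exists C; eapply filter_imp; [| exact HC].
  intros dt H t Ht.
  assert (ER : forall t, RInt (F dt t) 0 (2 * PI) = RInt (E dt t) 0 (2 * PI))
    by (intros z; apply RInt_ext; auto).
  rewrite ER, <- E0, <- E1; destruct (H t Ht) as [H1 [H2 H3]].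
  repeat split; [| assumption |].
  - apply (ex_RInt_ext (E dt t)); auto.
  - intros t' Ht'; rewrite ER; auto.
Qed.

Lemma cone_average_eq_integrand tn E F m0 m1 :
  cone_average tn E m0 m1 -> (forall dt t theta, E dt t theta = F dt t theta) ->
  cone_average tn F m0 m1.
Proof. intros HE EF; apply (cone_average_ext _ _ _ _ _ _ _ HE EF); reflexivity. Qed.

(** Sums are formed at the level of averages because the trace of a primitive on a plane through the
    apex need not be [cone_lipschitz]; it enters through [cone_average_zero]. *)
Lemma cone_average_plus tn E F m0 m1 n0 n1 :
  cone_average tn E m0 m1 -> cone_average tn F n0 n1 ->
  cone_average tn (fun dt t theta => E dt t theta + F dt t theta)
    (fun dt => m0 dt + n0 dt) (fun dt => m1 dt + n1 dt).
Proof.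
  intros [C HC] [C' HC']; exists (C + C').
  eapply filter_imp; [| exact (filter_and _ _ HC HC')].
  intros dt [H H'].
  assert (ER : forall t, Rabs (t - tn) <= dt / 2 ->
    RInt (fun theta => E dt t theta + F dt t theta) 0 (2 * PI)
    = RInt (E dt t) 0 (2 * PI) + RInt (F dt t) 0 (2 * PI)).
  { intros t Ht; apply (RInt_plus (V := R_CompleteNormedModule));
      [apply H | apply H']; assumption. }
  intros t Ht; destruct (H t Ht) as [H1 [H2 H3]], (H' t Ht) as [H1' [H2' H3']].
  repeat split.
  - apply (ex_RInt_plus (V := R_NormedModule)); assumption.
  - rewrite ER by assumption.
    match type of H2 with Rabs ?a <= _ => match type of H2' with Rabs ?b <= _ =>
      replace (_ - _) with (a + b) by ring end end.
    eapply Rle_trans; [apply Rabs_triang |]; lra.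
  - intros t' Ht'; specialize (H3 t' Ht'); specialize (H3' t' Ht').
    rewrite !ER by assumption.
    match type of H3 with Rabs ?a <= _ => match type of H3' with Rabs ?b <= _ =>
      replace (_ - _) with (a + b) by ring end end.
    eapply Rle_trans; [apply Rabs_triang |]; lra.
Qed.

Lemma cone_average_scal tn k E m0 m1 :
  cone_average tn E m0 m1 ->
  cone_average tn (fun dt t theta => k * E dt t theta)
    (fun dt => k * m0 dt) (fun dt => k * m1 dt).
Proof.
  intros [C HC]; exists (Rabs k * C); eapply filter_imp; [| exact HC].
  intros dt H.
  assert (ER : forall t, Rabs (t - tn) <= dt / 2 ->
    RInt (fun theta => k * E dt t theta) 0 (2 * PI) = k * RInt (E dt t) 0 (2 * PI)).
  { intros t Ht; apply (RInt_scal (V := R_CompleteNormedModule)); apply H; assumption. }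
  intros t Ht; destruct (H t Ht) as [H1 [H2 H3]]; repeat split.
  - apply (ex_RInt_scal (V := R_NormedModule)); assumption.
  - rewrite ER by assumption.
    match type of H2 with Rabs ?a <= _ => replace (_ - _) with (k * a) by ring end.
    rewrite Rabs_mult, Rmult_assoc; apply Rmult_le_compat_l; [apply Rabs_pos | exact H2].
  - intros t' Ht'; specialize (H3 t' Ht'); rewrite !ER by assumption.
    match type of H3 with Rabs ?a <= _ => replace (_ - _) with (k * a) by ring end.
    rewrite Rabs_mult, Rmult_assoc; apply Rmult_le_compat_l; [apply Rabs_pos | exact H3].
Qed.

Lemma cone_average_zero tn E :
  at_right 0 (fun dt => forall t, Rabs (t - tn) <= dt / 2 ->
    is_RInt (E dt t) 0 (2 * PI) 0) ->
  cone_average tn E (fun _ => 0) (fun _ => 0).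
Proof.
  intros HE; exists 0; eapply filter_imp; [| exact HE].
  intros dt H t Ht; rewrite (is_RInt_unique _ _ _ _ (H t Ht)); repeat split.
  - exists 0; apply H; assumption.
  - rewrite Rmult_0_r, Rplus_0_r, Rminus_0_r, Rabs_R0; right; ring.
  - intros t' Ht'; rewrite (is_RInt_unique _ _ _ _ (H t' Ht')).
    rewrite Rminus_0_r, Rabs_R0; right; ring.
Qed.

(** * Integrals over the base circle, with the singular weight, and over the mantle *)

Lemma O_square_base_RInt tn E (m0 m1 : R -> R) :
  cone_average tn E m0 m1 ->
  O_square (fun dt =>
    RInt (fun theta => E dt tn theta) 0 (2 * PI) - (m0 dt + dt / 2 * m1 dt)).
Proof.
  intros [C HC]; exists (C / 4); eapply filter_imp;
    [| exact (filter_and _ _ HC (at_right_0_lt 1 Rlt_0_1))].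
  intros dt [H Hdt].
  assert (Ht : Rabs (tn - tn) <= dt / 2) by (rewrite Rminus_eq_0, Rabs_R0; lra).
  destruct (H tn Ht) as [_ [H' _]].
  replace (tn + dt / 2 - tn) with (dt / 2) in H' by ring.
  eapply Rle_trans; [exact H' | right; field].
Qed.

(** When [m0] vanishes, dividing the circle integral by s leaves [m1 + O(s)], a nearly constant
    function on an interval of length [dt / 2]. *)
Lemma O_square_singular_RInt tn E (m0 m1 : R -> R) :
  cone_average tn E m0 m1 -> (forall dt, m0 dt = 0) ->
  O_square (fun dt =>
    RInt (fun t => / (tn + dt / 2 - t) * RInt (fun theta => E dt t theta) 0 (2 * PI))
      tn (tn + dt / 2) - dt / 2 * m1 dt).
Proof.
  intros [C HC] Hm0; exists (C / 4); eapply filter_imp;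
    [| exact (filter_and _ _ HC (at_right_0_lt 1 Rlt_0_1))].
  intros dt [H Hdt].
  replace (dt / 2 * m1 dt) with (m1 dt * (tn + dt / 2 - tn)) by ring.
  replace (C / 4 * dt ^ 2) with (C * (tn + dt / 2 - tn) ^ 2) by field.
  apply RInt_near_constant; [lra | |]; intros t Ht;
    assert (Ht' : Rabs (t - tn) <= dt / 2) by (apply Rabs_le; lra);
    destruct (H t Ht') as [_ [H1 H2]].
  - apply (continuous_mult (K := R_AbsRing) (fun t => / (tn + dt / 2 - t))).
    + apply continuous_Rinv_comp; [| lra].
      apply @continuous_minus; [apply continuous_const | apply continuous_id].
    + apply lipschitz_continuous with (C := C) (d := tn + dt / 2 - t); [lra |].
      intros z Hz; apply Rabs_def2 in Hz; apply H2, Rabs_le; lra.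
  - rewrite Hm0, Rplus_0_l in H1.
    apply Rmult_le_reg_l with (tn + dt / 2 - t); [lra |].
    rewrite <- (Rabs_pos_eq (tn + dt / 2 - t)) at 1 by lra.
    rewrite <- Rabs_mult.
    change (RInt (fun theta => E dt t theta)) with (RInt (E dt t)).
    replace (_ * (_ - _)) with
      (RInt (E dt t) 0 (2 * PI) - (tn + dt / 2 - t) * m1 dt) by (field; lra).
    eapply Rle_trans; [exact H1 | right; ring].
Qed.

(** Without the weight [1 / s] the time integration itself gains a power of [dt], so the value at
    the apex, where the circle has collapsed to a point, is accurate enough. *)
Lemma O_square_mantle_RInt tn E (A : R -> R) :
  cone_lipschitz tn E -> (forall dt theta, E dt (tn + dt / 2) theta = A dt) ->
  O_square (fun dt =>
    RInt (fun t => RInt (fun theta => E dt t theta) 0 (2 * PI)) tn (tn + dt / 2)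
    - dt / 2 * (2 * PI * A dt)).
Proof.
  intros HL HA.
  destruct (cone_lipschitz_RInt _ _ HL) as [C HC].
  pose proof (cone_lipschitz_RInt_continuous _ _ HL) as HK.
  exists (C / 4); eapply filter_imp;
    [| exact (filter_and _ _ (filter_and _ _ HC HK) (at_right_0_lt 1 Rlt_0_1))].
  intros dt [[H K] Hdt].
  replace (dt / 2 * (2 * PI * A dt)) with (2 * PI * A dt * (tn + dt / 2 - tn)) by ring.
  replace (C / 4 * dt ^ 2) with (C * (tn + dt / 2 - tn) ^ 2) by field.
  apply RInt_near_constant; [lra | exact K |].
  intros t Ht.
  assert (EA : RInt (E dt (tn + dt / 2)) 0 (2 * PI) = 2 * PI * A dt).
  { rewrite (RInt_ext _ (fun _ => A dt)) by (intros; apply HA).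
    rewrite RInt_const; unfold scal; simpl; unfold mult; simpl; ring. }
  rewrite <- EA.
  replace (tn + dt / 2 - t) with (Rabs (t - (tn + dt / 2)))
    by (rewrite Rabs_left by lra; ring).
  apply H; apply Rabs_le; lra.
Qed.

(** * Trigonometric moments *)

Lemma is_RInt_circle_derive (F f : R -> R) (l : R) :
  (forall z, is_derive F z (f z)) -> (forall z, continuous f z) ->
  F (2 * PI) - F 0 = l -> is_RInt f 0 (2 * PI) l.
Proof. intros HF Hf <-; apply @is_RInt_derive; auto. Qed.

(** Frequency 3 is the highest that occurs: the weights have frequency at most 2, and their first
    moments multiply them by [cos] or [sin]. *)
Lemma is_RInt_harmonic (a0 a1 b1 a2 b2 a3 b3 : R) :
  is_RInt (fun z => a0 + (a1 * cos z + b1 * sin z)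
                  + (a2 * cos (2 * z) + b2 * sin (2 * z))
                  + (a3 * cos (3 * z) + b3 * sin (3 * z)))
    0 (2 * PI) (2 * PI * a0).
Proof.
  apply is_RInt_circle_derive with
    (F := fun z => a0 * z + (a1 * sin z - b1 * cos z)
                 + (a2 * sin (2 * z) - b2 * cos (2 * z)) / 2
                 + (a3 * sin (3 * z) - b3 * cos (3 * z)) / 3).
  - intros z; auto_derive; [trivial | field].
  - intros z; apply (ex_derive_continuous (V := R_NormedModule)); auto_derive; trivial.
  - replace (2 * (2 * PI)) with (0 + 2 * INR 2 * PI) by (simpl; ring).
    replace (3 * (2 * PI)) with (0 + 2 * INR 3 * PI) by (simpl; ring).
    rewrite !sin_period, !cos_period, sin_2PI, cos_2PI, !Rmult_0_r, sin_0, cos_0.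
    field.
Qed.

(** The substitution [z = sin theta] maps both limits to 0, so continuity of [F] alone forces the
    integral to vanish. *)
Lemma is_RInt_sin_comp_cos (F : R -> R) :
  (forall z, -1 <= z <= 1 -> continuous F z) ->
  is_RInt (fun theta => F (sin theta) * cos theta) 0 (2 * PI) 0.
Proof.
  intros HF.
  apply (is_RInt_ext (fun theta => scal (cos theta) (F (sin theta)))).
  { intros; apply Rmult_comm. }
  replace 0 with (RInt F (sin 0) (sin (2 * PI))) at 2.
  - apply (is_RInt_comp F sin cos).
    + intros z _; apply HF, SIN_bound.
    + intros z _; split; [apply is_derive_sin | apply continuous_cos].
  - rewrite sin_0, sin_2PI; exact (RInt_point 0 F).
Qed.

Lemma is_RInt_cos_comp_sin (F : R -> R) :
  (forall z, -1 <= z <= 1 -> continuous F z) ->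
  is_RInt (fun theta => F (cos theta) * sin theta) 0 (2 * PI) 0.
Proof.
  intros HF.
  apply (is_RInt_ext (fun theta => scal (- sin theta) (- F (cos theta)))).
  { intros theta _; change (- sin theta * - F (cos theta) = F (cos theta) * sin theta); ring. }
  replace 0 with (RInt (fun z => - F z) (cos 0) (cos (2 * PI))) at 2.
  - apply (is_RInt_comp (fun z => - F z) cos (fun z => - sin z)).
    + intros z _; apply (continuous_opp (V := R_NormedModule)), HF, COS_bound.
    + intros z _; split; [apply is_derive_cos |].
      apply (continuous_opp (V := R_NormedModule)), continuous_sin.
  - rewrite cos_0, cos_2PI; exact (RInt_point 1 (fun z => - F z)).
Qed.

Lemma is_RInt_trig (f : R -> R) (l a0 a1 b1 a2 b2 a3 b3 : R) :
  (forall z, a0 + (a1 * cos z + b1 * sin z)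
             + (a2 * cos (2 * z) + b2 * sin (2 * z))
             + (a3 * cos (3 * z) + b3 * sin (3 * z)) = f z) ->
  2 * PI * a0 = l -> is_RInt f 0 (2 * PI) l.
Proof.
  intros Hf <-; eapply is_RInt_ext; [intros z _; apply Hf |].
  apply is_RInt_harmonic.
Qed.

Lemma cos_3a z : cos (3 * z) = 4 * cos z ^ 3 - 3 * cos z.
Proof.
  replace (3 * z) with (2 * z + z) by ring.
  rewrite cos_plus, cos_2a_cos, sin_2a.
  replace (2 * sin z * cos z * sin z) with (2 * cos z * (Rsqr (sin z))) by (unfold Rsqr; ring).
  rewrite sin2; unfold Rsqr; ring.
Qed.

Lemma sin_3a z : sin (3 * z) = 4 * sin z * cos z ^ 2 - sin z.
Proof.
  replace (3 * z) with (2 * z + z) by ring.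
  rewrite sin_plus, cos_2a_cos, sin_2a; ring.
Qed.

(** The first-order coefficient on the mantle is affine in [cos theta] and [sin theta], so these
    three moments determine its weighted circle integral. *)
Definition trig_weight (phi : R -> R) (mu0 mu1 mu2 : R) : Prop :=
  (forall z, continuous phi z) /\ (forall z, Rabs (phi z) <= 1) /\
  is_RInt phi 0 (2 * PI) mu0 /\
  is_RInt (fun z => cos z * phi z) 0 (2 * PI) mu1 /\
  is_RInt (fun z => sin z * phi z) 0 (2 * PI) mu2.

Ltac trig_identity :=
  let z := fresh "z" in intros z;
  rewrite ?cos_3a, ?sin_3a, ?cos_2a_cos, ?sin_2a;
  let E := fresh "E" in
  assert (E : sin z * sin z = 1 - cos z * cos z)
    by (pose proof (sin2_cos2 z); unfold Rsqr in *; lra);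
  field [E].

Ltac trig_continuous :=
  let z := fresh "z" in intros z;
  apply (ex_derive_continuous (V := R_NormedModule)); auto_derive; trivial.

Ltac trig_bounded :=
  let z := fresh "z" in intros z;
  pose proof (SIN_bound z); pose proof (COS_bound z);
  pose proof (SIN_bound (2 * z)); pose proof (COS_bound (2 * z));
  pose proof (sin2_cos2 z); unfold Rsqr in *; apply Rabs_le; split; nra.

Lemma trig_weight_1 : trig_weight (fun _ => 1) (2 * PI) 0 0.
Proof.
  split; [trig_continuous |]; split; [trig_bounded |]; repeat split.
  - apply (is_RInt_trig _ _ 1 0 0 0 0 0 0); [trig_identity | field].
  - apply (is_RInt_trig _ _ 0 1 0 0 0 0 0); [trig_identity | field].
  - apply (is_RInt_trig _ _ 0 0 1 0 0 0 0); [trig_identity | field].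
Qed.

Lemma trig_weight_cos : trig_weight cos 0 PI 0.
Proof.
  split; [trig_continuous |]; split; [trig_bounded |]; repeat split.
  - apply (is_RInt_trig _ _ 0 1 0 0 0 0 0); [trig_identity | field].
  - apply (is_RInt_trig _ _ (1/2) 0 0 (1/2) 0 0 0); [trig_identity | field].
  - apply (is_RInt_trig _ _ 0 0 0 0 (1/2) 0 0); [trig_identity | field].
Qed.

Lemma trig_weight_sin : trig_weight sin 0 0 PI.
Proof.
  split; [trig_continuous |]; split; [trig_bounded |]; repeat split.
  - apply (is_RInt_trig _ _ 0 0 1 0 0 0 0); [trig_identity | field].
  - apply (is_RInt_trig _ _ 0 0 0 0 (1/2) 0 0); [trig_identity | field].
  - apply (is_RInt_trig _ _ (1/2) 0 0 (-1/2) 0 0 0); [trig_identity | field].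
Qed.

Lemma trig_weight_cos_sqr : trig_weight (fun z => cos z ^ 2) PI 0 0.
Proof.
  split; [trig_continuous |]; split; [trig_bounded |]; repeat split.
  - apply (is_RInt_trig _ _ (1/2) 0 0 (1/2) 0 0 0); [trig_identity | field].
  - apply (is_RInt_trig _ _ 0 (3/4) 0 0 0 (1/4) 0); [trig_identity | field].
  - apply (is_RInt_trig _ _ 0 0 (1/4) 0 0 0 (1/4)); [trig_identity | field].
Qed.

Lemma trig_weight_sin_sqr : trig_weight (fun z => sin z ^ 2) PI 0 0.
Proof.
  split; [trig_continuous |]; split; [trig_bounded |]; repeat split.
  - apply (is_RInt_trig _ _ (1/2) 0 0 (-1/2) 0 0 0); [trig_identity | field].
  - apply (is_RInt_trig _ _ 0 (1/4) 0 0 0 (-1/4) 0); [trig_identity | field].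
  - apply (is_RInt_trig _ _ 0 0 (3/4) 0 0 0 (-1/4)); [trig_identity | field].
Qed.

Lemma trig_weight_sin_cos : trig_weight (fun z => sin z * cos z) 0 0 0.
Proof.
  split; [trig_continuous |]; split; [trig_bounded |]; repeat split.
  - apply (is_RInt_trig _ _ 0 0 0 0 (1/2) 0 0); [trig_identity | field].
  - apply (is_RInt_trig _ _ 0 0 (1/4) 0 0 0 (1/4)); [trig_identity | field].
  - apply (is_RInt_trig _ _ 0 (1/4) 0 0 0 (-1/4) 0); [trig_identity | field].
Qed.

Lemma trig_weight_cos_2a : trig_weight (fun z => cos (2 * z)) 0 0 0.
Proof.
  split; [trig_continuous |]; split; [trig_bounded |]; repeat split.
  - apply (is_RInt_trig _ _ 0 0 0 1 0 0 0); [trig_identity | field].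
  - apply (is_RInt_trig _ _ 0 (1/2) 0 0 0 (1/2) 0); [trig_identity | field].
  - apply (is_RInt_trig _ _ 0 0 (-1/2) 0 0 0 (1/2)); [trig_identity | field].
Qed.

Lemma trig_weight_sin_2a : trig_weight (fun z => sin (2 * z)) 0 0 0.
Proof.
  split; [trig_continuous |]; split; [trig_bounded |]; repeat split.
  - apply (is_RInt_trig _ _ 0 0 0 0 1 0 0); [trig_identity | field].
  - apply (is_RInt_trig _ _ 0 0 (1/2) 0 0 0 (1/2)); [trig_identity | field].
  - apply (is_RInt_trig _ _ 0 (1/2) 0 0 0 (-1/2) 0); [trig_identity | field].
Qed.

(** * Averages of smooth functions and of primitives *)

Lemma cone_average_taylor ut vt ct x y tn w wx wy wt phi mu0 mu1 mu2 :
  lipschitz_near (x, y, tn) w -> taylor_near (x, y, tn) w wx wy wt ->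
  trig_weight phi mu0 mu1 mu2 ->
  cone_average tn
    (fun dt t theta =>
       w (cone_mantle ut vt ct (x, y, tn + dt / 2) t theta) * phi theta)
    (fun dt => w (x, y, tn + dt / 2) * mu0)
    (fun dt => let p := (x, y, tn + dt / 2) in
       - (ut * wx p + vt * wy p + wt p) * mu0 + ct * (wx p * mu1 + wy p * mu2)).
Proof.
  intros HL HT [Hc [Hb [H0 [H1 H2]]]].
  eapply cone_average_expands.
  - apply cone_lipschitz_mult with (M := 1); [assumption | assumption |].
    apply cone_lipschitz_near, HL.
  - apply cone_expands_mult with (M := 1); [assumption |].
    apply cone_expands_taylor, HT.
  - intros dt; apply (is_RInt_scal (V := R_NormedModule) phi), H0.
  - intros dt; cbv zeta.
    eapply is_RInt_ext; [| apply (is_RInt_plus (V := R_NormedModule));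
      [apply (is_RInt_scal (V := R_NormedModule) phi), H0
      | apply (is_RInt_scal (V := R_NormedModule)),
          (is_RInt_plus (V := R_NormedModule));
        [apply (is_RInt_scal (V := R_NormedModule)), H1
        | apply (is_RInt_scal (V := R_NormedModule)), H2]]].
    intros z _; unfold plus, scal; simpl; unfold mult; simpl; ring.
Qed.

Lemma lipschitz_near_lincomb p0 a b w w' :
  lipschitz_near p0 w -> lipschitz_near p0 w' ->
  lipschitz_near p0 (fun p => a * w p + b * w' p).
Proof.
  intros [r [C [Hr [HC H]]]] [r' [C' [Hr' [HC' H']]]].
  exists (Rmin r r'), (Rabs a * C + Rabs b * C').
  split; [apply Rmin_pos; assumption |].
  split.
  { apply Rplus_le_le_0_compat; apply Rmult_le_pos; auto using Rabs_pos. }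
  intros p q Hp Hq.
  assert (K : Rabs (w p - w q) <= C * dist1 p q)
    by (apply H; eapply box_le; try eassumption; apply Rmin_l).
  assert (K' : Rabs (w' p - w' q) <= C' * dist1 p q)
    by (apply H'; eapply box_le; try eassumption; apply Rmin_r).
  replace (_ - _) with (a * (w p - w q) + b * (w' p - w' q)) by ring.
  eapply Rle_trans; [apply Rabs_triang |]; rewrite !Rabs_mult.
  pose proof (Rmult_le_compat_l _ _ _ (Rabs_pos a) K).
  pose proof (Rmult_le_compat_l _ _ _ (Rabs_pos b) K').
  lra.
Qed.

Lemma continuous_pair3 (a b c : R -> R) (z : R) :
  continuous a z -> continuous b z -> continuous c z ->
  continuous (fun z => (a z, b z, c z)) z.
Proof.
  intros Ha Hb Hc.
  apply (continuous_comp_2 (fun z => (a z, b z)) c pair); [| assumption |].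
  - apply (continuous_comp_2 a b pair); [assumption | assumption |].
    apply (continuous_ext (fun p => p)); [intros []; reflexivity | apply continuous_id].
  - apply (continuous_ext (fun p => p)); [intros []; reflexivity | apply continuous_id].
Qed.

(* The primitive is not differentiable transversally, but [V (x, _, t)] depends
   on [theta] through [sin theta] only and is thus orthogonal to [cos theta];
   what remains of [V] is its increment from the plane through the apex. *)
Lemma cone_average_x_primitive (D : R * R * R -> Prop) (V W : R * R * R -> R)
  (ut vt ct x y tn : R) :
  open D -> D (x, y, tn) -> x_primitive D V W -> lipschitz_near (x, y, tn) W ->
  cone_average tn
    (fun dt t theta =>
       V (cone_mantle ut vt ct (x, y, tn + dt / 2) t theta) * cos theta)
    (fun _ => 0) (fun dt => ct * (W (x, y, tn + dt / 2) * PI)).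
Proof.
  intros HD HP [Vc Vd] HW.
  destruct (locally_box _ _ (HD _ HP)) as [r [Hr Br]].
  destruct (x_increment_regular V W x y tn r) as [HL HT]; auto.
  pose proof (cone_average_taylor ut vt ct x y tn _ _ _ _ _ _ _ _ HL HT
    trig_weight_cos) as A1.
  assert (A2 : cone_average tn (fun dt t theta =>
    let q := cone_mantle ut vt ct (x, y, tn + dt / 2) t theta in
    V (x, snd (fst q), snd q) * cos theta) (fun _ => 0) (fun _ => 0)).
  { apply cone_average_zero; eapply filter_imp;
      [| apply (cone_mantle_in_box ut vt ct x y tn r Hr)].
    intros dt Hb t Ht; cbn [cone_mantle fst snd].
    set (s := tn + dt / 2 - t).
    apply (is_RInt_sin_comp_cos (fun z => V (x, y - vt * s + ct * s * z, t))).
    intros z Hz.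
    apply (continuous_comp (fun z => (x, y - vt * s + ct * s * z, t)) V).
    - apply continuous_pair3; try apply continuous_const.
      apply (ex_derive_continuous (V := R_NormedModule)); auto_derive; trivial.
    - apply Vc, Br.
      (* The mantle point in direction [asin z] has the required y-coordinate, which places the
         projected point in the box as well. *)
      specialize (Hb t (asin z) Ht); cbn [cone_mantle box] in Hb |- *.
      rewrite sin_asin in Hb by lra; fold s in Hb.
      rewrite Rminus_eq_0, Rabs_R0; tauto. }
  apply (cone_average_ext _ _ _ _ _ _ _ (cone_average_plus _ _ _ _ _ _ _ A1 A2));
    intros; unfold x_increment; cbv beta zeta; ring.
Qed.

Lemma cone_average_y_primitive (D : R * R * R -> Prop) (U W : R * R * R -> R)
  (ut vt ct x y tn : R) :
  open D -> D (x, y, tn) -> y_primitive D U W -> lipschitz_near (x, y, tn) W ->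
  cone_average tn
    (fun dt t theta =>
       U (cone_mantle ut vt ct (x, y, tn + dt / 2) t theta) * sin theta)
    (fun _ => 0) (fun dt => ct * (W (x, y, tn + dt / 2) * PI)).
Proof.
  intros HD HP [Uc Ud] HW.
  destruct (locally_box _ _ (HD _ HP)) as [r [Hr Br]].
  destruct (y_increment_regular U W x y tn r) as [HL HT]; auto.
  pose proof (cone_average_taylor ut vt ct x y tn _ _ _ _ _ _ _ _ HL HT
    trig_weight_sin) as A1.
  assert (A2 : cone_average tn (fun dt t theta =>
    let q := cone_mantle ut vt ct (x, y, tn + dt / 2) t theta in
    U (fst (fst q), y, snd q) * sin theta) (fun _ => 0) (fun _ => 0)).
  { apply cone_average_zero; eapply filter_imp;
      [| apply (cone_mantle_in_box ut vt ct x y tn r Hr)].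
    intros dt Hb t Ht; cbn [cone_mantle fst snd].
    set (s := tn + dt / 2 - t).
    apply (is_RInt_cos_comp_sin (fun z => U (x - ut * s + ct * s * z, y, t))).
    intros z Hz.
    apply (continuous_comp (fun z => (x - ut * s + ct * s * z, y, t)) U).
    - apply continuous_pair3; try apply continuous_const.
      apply (ex_derive_continuous (V := R_NormedModule)); auto_derive; trivial.
    - apply Uc, Br.
      specialize (Hb t (acos z) Ht); cbn [cone_mantle box] in Hb |- *.
      rewrite cos_acos in Hb by lra; fold s in Hb.
      rewrite Rminus_eq_0, Rabs_R0; tauto. }
  apply (cone_average_ext _ _ _ _ _ _ _ (cone_average_plus _ _ _ _ _ _ _ A1 A2));
    intros; unfold y_increment; cbv beta zeta; ring.
Qed.

Lemma O_square_axis ut vt x y tn w wx wy wt :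
  taylor_near (x, y, tn) w wx wy wt ->
  O_square (fun dt => let p := (x, y, tn + dt / 2) in
    w (cone_axis ut vt p tn)
    - (w p - dt / 2 * (ut * wx p + vt * wy p + wt p))).
Proof.
  (* The axis is the degenerate mantle with [ct = 0]. *)
  intros HT; destruct (cone_expands_taylor ut vt 0 _ _ _ _ _ _ _ HT) as [C HC].
  exists (C / 4); eapply filter_imp;
    [| exact (filter_and _ _ HC (at_right_0_lt 1 Rlt_0_1))].
  intros dt [H Hdt]; cbv zeta.
  assert (Ht : Rabs (tn - tn) <= dt / 2) by (rewrite Rminus_eq_0, Rabs_R0; lra).
  specialize (H tn 0 Ht); cbv beta zeta in H.
  replace (cone_axis ut vt (x, y, tn + dt / 2) tn)
    with (cone_mantle ut vt 0 (x, y, tn + dt / 2) tn 0)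
    by (apply (f_equal2 pair); [apply (f_equal2 pair); cbn; ring | reflexivity]).
  replace (tn + dt / 2 - tn) with (dt / 2) in H by ring.
  replace (C / 4 * dt ^ 2) with (C * (dt / 2) ^ 2) by field.
  eapply Rle_trans; [right | exact H].
  f_equal; ring.
Qed.

Lemma partial_t_steady b p : partial_t (steady b) p = 0.
Proof. destruct p as [[x y] t]; exact (Derive_const (b (x, y)) t). Qed.

(** * Cancellation of the first-order terms *)

Theorem lemma3p2
  (D : R * R * R -> Prop) (ht ut vt g f : R)
  (b : R * R -> R) (h u v U V : R * R * R -> R) (x y tn : R)
  (hD : open D) (hP : D (x, y, tn))
  (hht : 0 < ht) (hg : 0 < g)
  (sb : Ck_in D 2 (steady b))
  (sh : Ck_in D 2 h) (su : Ck_in D 2 u) (sv : Ck_in D 2 v)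
  (hsol : linearized_shallow_water D ht ut vt g f b h u v)
  (hV : x_primitive D V (fun p => f / g * v p))
  (hU : y_primitive D U (fun p => f / g * u p)) :
  let ct := sqrt (g * ht) in
  let K := fun p => g * (h p + steady b p - V p) in
  let L := fun p => g * (h p + steady b p + U p) in
  let P := fun dt => (x, y, tn + dt / 2) in
  let Qt := fun dt t' theta => cone_mantle ut vt ct (P dt) t' theta in
  let Q := fun dt theta => Qt dt tn theta in
  let Q0 := fun dt => cone_axis ut vt (P dt) tn in
  O_square (fun dt =>
    h (P dt) -
    ( - steady b (P dt)
      + / (2 * PI) * RInt (fun theta =>
          (h (Q dt theta) + steady b (Q dt theta))
          - ct / g * (u (Q dt theta) * cos theta + v (Q dt theta) * sin theta))
          0 (2 * PI)
      - / (2 * PI) * RInt (fun t' => / (tn + dt / 2 - t') *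
          RInt (fun theta =>
            ct / g * (u (Qt dt t' theta) * cos theta
                      + v (Qt dt t' theta) * sin theta)) 0 (2 * PI))
          tn (tn + dt / 2)
      + / (2 * PI) * RInt (fun t' =>
          RInt (fun theta =>
            ut * partial_x (steady b) (Qt dt t' theta)
            + vt * partial_y (steady b) (Qt dt t' theta)) 0 (2 * PI))
          tn (tn + dt / 2)))
  /\
  O_square (fun dt =>
    u (P dt) -
    ( / (2 * PI) * RInt (fun theta =>
          - / ct * K (Q dt theta) * cos theta
          + u (Q dt theta) * cos theta ^ 2
          + v (Q dt theta) * sin theta * cos theta) 0 (2 * PI)
      + / 2 * u (Q0 dt)
      - / (2 * PI) * RInt (fun t' => / (tn + dt / 2 - t') *
          RInt (fun theta => / ct * K (Qt dt t' theta) * cos theta) 0 (2 * PI))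
          tn (tn + dt / 2)
      + / (2 * PI) * RInt (fun t' => / (tn + dt / 2 - t') *
          RInt (fun theta =>
            u (Qt dt t' theta) * cos (2 * theta)
            + v (Qt dt t' theta) * sin (2 * theta)) 0 (2 * PI))
          tn (tn + dt / 2)))
  /\
  O_square (fun dt =>
    v (P dt) -
    ( / (2 * PI) * RInt (fun theta =>
          - / ct * L (Q dt theta) * sin theta
          + u (Q dt theta) * sin theta * cos theta
          + v (Q dt theta) * sin theta ^ 2) 0 (2 * PI)
      + / 2 * v (Q0 dt)
      - / (2 * PI) * RInt (fun t' => / (tn + dt / 2 - t') *
          RInt (fun theta => / ct * L (Qt dt t' theta) * sin theta) 0 (2 * PI))
          tn (tn + dt / 2)
      + / (2 * PI) * RInt (fun t' => / (tn + dt / 2 - t') *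
          RInt (fun theta =>
            u (Qt dt t' theta) * sin (2 * theta)
            - v (Qt dt t' theta) * cos (2 * theta)) 0 (2 * PI))
          tn (tn + dt / 2))).
Proof.
  intros ct K L P Qt Q Q0.
  assert (Hct : 0 < ct) by (apply sqrt_lt_R0, Rmult_lt_0_compat; assumption).
  assert (Hht : ht = ct * ct / g).
  { unfold ct; rewrite sqrt_sqrt; [field; lra |].
    apply Rlt_le, Rmult_lt_0_compat; assumption. }
  pose proof PI_RGT_0 as HPI.
  assert (HPD : at_right 0 (fun dt => D (P dt))).
  { destruct (locally_box _ _ (hD _ hP)) as [r [Hr Br]].
    eapply filter_imp; [| exact (filter_and _ _
      (cone_mantle_in_box ut vt ct x y tn r Hr) (at_right_0_lt 1 Rlt_0_1))].
    intros dt [Hb Hdt]; apply Br; unfold P.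
    rewrite <- (cone_mantle_apex ut vt ct x y (tn + dt / 2) 0).
    apply Hb, Rabs_le; lra. }
  assert (HL : forall w, Ck_in D 2 w -> lipschitz_near (x, y, tn) w)
    by (intros; apply (C1_lipschitz_near D); auto using Ck_in_S).
  assert (HT : forall w, Ck_in D 2 w -> taylor_near (x, y, tn) w
                 (partial_x w) (partial_y w) (partial_t w))
    by (intros; apply (C2_taylor_near D); auto).
  assert (HA : forall w phi mu0 mu1 mu2,
    Ck_in D 2 w -> trig_weight phi mu0 mu1 mu2 ->
    cone_average tn (fun dt t theta => w (Qt dt t theta) * phi theta)
      (fun dt => w (P dt) * mu0)
      (fun dt => - (ut * partial_x w (P dt) + vt * partial_y w (P dt)
                    + partial_t w (P dt)) * mu0
                 + ct * (partial_x w (P dt) * mu1 + partial_y w (P dt) * mu2)))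
    by (intros; apply cone_average_taylor; auto).
  assert (HV : cone_average tn (fun dt t theta => V (Qt dt t theta) * cos theta)
    (fun _ => 0) (fun dt => ct * (f / g * v (P dt) * PI))).
  { apply (cone_average_x_primitive D _ _ _ _ _ _ _ _ hD hP hV).
    eapply lipschitz_near_ext; [| apply (lipschitz_near_lincomb _ (f / g) 0 v v); auto].
    intros p; cbv beta; ring. }
  assert (HU : cone_average tn (fun dt t theta => U (Qt dt t theta) * sin theta)
    (fun _ => 0) (fun dt => ct * (f / g * u (P dt) * PI))).
  { apply (cone_average_y_primitive D _ _ _ _ _ _ _ _ hD hP hU).
    eapply lipschitz_near_ext; [| apply (lipschitz_near_lincomb _ (f / g) 0 u u); auto].
    intros p; cbv beta; ring. }
  pose proof (HA _ _ _ _ _ su trig_weight_cos) as Au_cos.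
  pose proof (HA _ _ _ _ _ sv trig_weight_sin) as Av_sin.
  pose proof (HA _ _ _ _ _ sh trig_weight_cos) as Ah_cos.
  pose proof (HA _ _ _ _ _ sb trig_weight_cos) as Ab_cos.
  pose proof (HA _ _ _ _ _ sh trig_weight_sin) as Ah_sin.
  pose proof (HA _ _ _ _ _ sb trig_weight_sin) as Ab_sin.
  (* The first moments are [ct * PI] times the divergence for [A_div], and [ct * PI / g] times the
     x-derivative of [K] and the y-derivative of [L] for [A_K] and [A_L]; all three have
     [m0 = 0]. *)
  pose proof (cone_average_plus _ _ _ _ _ _ _ Au_cos Av_sin) as A_div.
  pose proof (cone_average_plus _ _ _ _ _ _ _
    (cone_average_plus _ _ _ _ _ _ _ Ah_cos Ab_cos)
    (cone_average_scal _ (-1) _ _ _ HV)) as A_K.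
  pose proof (cone_average_plus _ _ _ _ _ _ _
    (cone_average_plus _ _ _ _ _ _ _ Ah_sin Ab_sin) HU) as A_L.
  split; [| split].
  (* With div the divergence at the apex, the mean of [h] contributes [ht * div] per unit time, by
     the first equation. The velocity terms of the base and of the singular integral each take away
     half of it. The drift of [steady b] is offset by the mantle integral. *)
  - pose proof (O_square_base_RInt tn _
      _ _ (cone_average_eq_integrand _ _
      (fun dt t theta =>
        (h (Qt dt t theta) + steady b (Qt dt t theta))
        - ct / g * (u (Qt dt t theta) * cos theta + v (Qt dt t theta) * sin theta)) _ _
        (cone_average_plus _ _ _ _ _ _ _
          (cone_average_plus _ _ _ _ _ _ _
            (HA _ _ _ _ _ sh trig_weight_1) (HA _ _ _ _ _ sb trig_weight_1))
          (cone_average_scal _ (- (ct / g)) _ _ _ A_div))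
        ltac:(intros; cbv beta; field; lra))) as R1.
    pose proof (O_square_singular_RInt _ _ _ _
      (cone_average_scal _ (ct / g) _ _ _ A_div)
      ltac:(intros; cbv beta; ring)) as R2.
    pose proof (O_square_mantle_RInt tn (fun dt t theta =>
        ut * partial_x (steady b) (Qt dt t theta)
        + vt * partial_y (steady b) (Qt dt t theta))
      (fun dt => ut * partial_x (steady b) (P dt) + vt * partial_y (steady b) (P dt)))
      as R3.
    lapply R3; [clear R3; intros R3 |].
    2: { apply (cone_lipschitz_near ut vt ct x y tn
           (fun p => ut * partial_x (steady b) p + vt * partial_y (steady b) p)).
         apply Ck_in_partials in sb as [_ [Sx [Sy _]]].
         apply lipschitz_near_lincomb; apply (C1_lipschitz_near D); assumption. }
    lapply R3; [clear R3; intros R3 |].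
    2: { intros; unfold Qt, P; rewrite cone_mantle_apex; reflexivity. }
    (* Each remainder carries the sign of its integral in the residual, opposite to that in the
       bracket. The two sides then agree exactly as soon as [P dt] lies in [D]. *)
    refine (O_square_ext _ _ _ (O_square_plus _ _
      (O_square_scal (- / (2 * PI)) _ R1)
      (O_square_plus _ _ (O_square_scal (/ (2 * PI)) _ R2)
        (O_square_scal (- / (2 * PI)) _ R3)))).
    eapply filter_imp; [| exact HPD].
    intros dt Hp; destruct (hsol _ Hp) as [E _].
    assert (Et : partial_t h (P dt) =
      - (ut * partial_x h (P dt) + vt * partial_y h (P dt)
         + ct * ct / g * (partial_x u (P dt) + partial_y v (P dt))))
      by (rewrite <- Hht; lra).
    cbv beta; rewrite Et, partial_t_steady.
    unfold Q; field; lra.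
  (* The derivative of [u] along the flow equals minus the x-derivative of [K]. Hence the
     first-order terms of the base integral cancel among themselves, that of [u (Q0 dt)] cancels the
     singular [K] integral, and the weights of frequency 2 have no first moments. The third equation
     behaves alike with [L]. *)
  - pose proof (O_square_base_RInt tn _
      _ _ (cone_average_eq_integrand _ _
      (fun dt t theta =>
        - / ct * K (Qt dt t theta) * cos theta
        + u (Qt dt t theta) * cos theta ^ 2
        + v (Qt dt t theta) * sin theta * cos theta) _ _
        (cone_average_plus _ _ _ _ _ _ _
          (cone_average_plus _ _ _ _ _ _ _
            (cone_average_scal _ (- (g / ct)) _ _ _ A_K)
            (HA _ _ _ _ _ su trig_weight_cos_sqr))
          (HA _ _ _ _ _ sv trig_weight_sin_cos))
        ltac:(intros; unfold K; cbv beta; field; lra))) as R1.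
    pose proof (O_square_axis ut vt _ _ _ _ _ _ _ (HT _ su)) as R2.
    pose proof (O_square_singular_RInt tn
      _ _ _
      (cone_average_eq_integrand _ _
      (fun dt t theta => / ct * K (Qt dt t theta) * cos theta) _ _
        (cone_average_scal _ (g / ct) _ _ _ A_K)
        ltac:(intros; unfold K; cbv beta; field; lra))
      ltac:(intros; cbv beta; ring)) as R3.
    pose proof (O_square_singular_RInt _ _ _ _
      (cone_average_plus _ _ _ _ _ _ _
        (HA _ _ _ _ _ su trig_weight_cos_2a) (HA _ _ _ _ _ sv trig_weight_sin_2a))
      ltac:(intros; cbv beta; ring)) as R4.
    refine (O_square_ext _ _ _ (O_square_plus _ _
      (O_square_plus _ _
        (O_square_scal (- / (2 * PI)) _ R1) (O_square_scal (- / 2) _ R2))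
      (O_square_plus _ _
        (O_square_scal (/ (2 * PI)) _ R3) (O_square_scal (- / (2 * PI)) _ R4)))).
    eapply filter_imp; [| exact HPD].
    intros dt Hp; destruct (hsol _ Hp) as [_ [E _]].
    assert (Et : partial_t u (P dt) =
      - (ut * partial_x u (P dt) + vt * partial_y u (P dt)
         + g * partial_x h (P dt) + g * partial_x (steady b) (P dt)
         - f * v (P dt))) by lra.
    cbv beta zeta; fold (P dt); rewrite Et.
    unfold Q, Q0; field; lra.
  - pose proof (O_square_base_RInt tn _
      _ _ (cone_average_eq_integrand _ _
      (fun dt t theta =>
        - / ct * L (Qt dt t theta) * sin theta
        + u (Qt dt t theta) * sin theta * cos theta
        + v (Qt dt t theta) * sin theta ^ 2) _ _
        (cone_average_plus _ _ _ _ _ _ _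
          (cone_average_plus _ _ _ _ _ _ _
            (cone_average_scal _ (- (g / ct)) _ _ _ A_L)
            (HA _ _ _ _ _ su trig_weight_sin_cos))
          (HA _ _ _ _ _ sv trig_weight_sin_sqr))
        ltac:(intros; unfold L; cbv beta; field; lra))) as R1.
    pose proof (O_square_axis ut vt _ _ _ _ _ _ _ (HT _ sv)) as R2.
    pose proof (O_square_singular_RInt tn
      _ _ _
      (cone_average_eq_integrand _ _
      (fun dt t theta => / ct * L (Qt dt t theta) * sin theta) _ _
        (cone_average_scal _ (g / ct) _ _ _ A_L)
        ltac:(intros; unfold L; cbv beta; field; lra))
      ltac:(intros; cbv beta; ring)) as R3.
    pose proof (O_square_singular_RInt tn
      _ _ _
      (cone_average_eq_integrand _ _
      (fun dt t theta => u (Qt dt t theta) * sin (2 * theta)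
                         - v (Qt dt t theta) * cos (2 * theta)) _ _
        (cone_average_plus _ _ _ _ _ _ _
          (HA _ _ _ _ _ su trig_weight_sin_2a)
          (cone_average_scal _ (-1) _ _ _ (HA _ _ _ _ _ sv trig_weight_cos_2a)))
        ltac:(intros; cbv beta; ring))
      ltac:(intros; cbv beta; ring)) as R4.
    refine (O_square_ext _ _ _ (O_square_plus _ _
      (O_square_plus _ _
        (O_square_scal (- / (2 * PI)) _ R1) (O_square_scal (- / 2) _ R2))
      (O_square_plus _ _
        (O_square_scal (/ (2 * PI)) _ R3) (O_square_scal (- / (2 * PI)) _ R4)))).
    eapply filter_imp; [| exact HPD].
    intros dt Hp; destruct (hsol _ Hp) as [_ [_ E]].
    assert (Et : partial_t v (P dt) =
      - (ut * partial_x v (P dt) + vt * partial_y v (P dt)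
         + g * partial_y h (P dt) + g * partial_y (steady b) (P dt)
         + f * u (P dt))) by lra.
    cbv beta zeta; fold (P dt); rewrite Et.
    unfold Q, Q0; field; lra.
Qed.
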